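(* Let $\mathfrak{g}=\mathfrak{h}\rtimes_D\mathbb{R}$ be a four-dimensional almost abelian real Lie algebra with basis $\{e_1,e_2,e_3,e_4\}$, $\mathfrak{h}=\mathrm{span}_{\mathbb R}\{e_1,e_2,e_3\}$, $D=\mathrm{ad}(e_4)|_{\mathfrak{h}}$, equipped with the neutral metric $g=e^1\otimes e^1+e^2\otimes e^2-e^3\otimes e^3-e^4\otimes e^4$, and let $\varphi\in\mathfrak{g}^*$ and $H\in\Lambda^3\mathfrak{g}^*$. Then $\varphi$ and $H$ are closed and $(\mathfrak{g},g,\varphi,H)$ admits a non-zero left-invariant irreducible real chiral spinor $\xi$ of chirality $\mu=1$ satisfying $$\nabla^{S,H}\xi=0,\qquad \varphi\cdot\xi=H\cdot\xi$$ if and only if, up to replacing $\{e_1,e_2,e_3\}$ by another basis of $\mathfrak{h}$ inducing the same orientation and in which $g$ has the same form, there are real numbers $d_{11},d_{12},d_{21},d_{22},d_{32},\varphi_1,\varphi_2$ such that $$D=\begin{pmatrix} d_{11}&d_{12}&d_{12}\\ d_{21}&d_{22}&-d_{11}+d_{22}\\ -d_{21}&d_{32}&d_{11}+d_{32}\end{pmatrix}$$ and $$\varphi=\varphi_1e^1+\varphi_2(e^2+e^3)+(\varphi_1+d_{11}+d_{22}+d_{32})e^4,$$ $$H=2d_{11}e^{123}-(d_{12}+d_{21})(e^{124}+e^{134})+(d_{11}-d_{22}-d_{32})e^{234},$$ satisfying $$d_{11}\mathrm{Tr}(D)=0,\qquad d_{11}\varphi_1=0,\qquad d_{12}\varphi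_1+(d_{22}+d_{32})\varphi_2=0.$$
   Context: Almost abelian: $\mathfrak{g}$ is non-abelian with a codimension-one abelian ideal $\mathfrak{h}$. The brackets are $[e_i,e_j]=0$, $[e_4,e_i]=De_i=d_{1i}e_1+d_{2i}e_2+d_{3i}e_3$ for $i,j\in\{1,2,3\}$, where $D=(d_{ij})$. $\{e^1,\dots,e^4\}$ is the dual basis and $e^{ab\cdots}=e^a\wedge e^b\wedge\cdots$. ''Closed'' refers to the Chevalley-Eilenberg differential. The orientation is given by $\nu=e^{1234}$. Let $G$ be the connected, simply connected Lie group with Lie algebra $\mathfrak{g}$, with the left-invariant metric $g$ of signature $(2,2)$; elements of $\Lambda\mathfrak{g}^*$ are identified with left-invariant forms on $G$. Let $\gamma:\mathrm{Cl}(\mathfrak{g}^*,g^* )\to\mathrm{End}(\Sigma)$, $\Sigma\cong\mathbb{R}^4$, be the irreducible real module of the Clifford algebra with $\theta^2=g^*(\theta,\theta)$. $G$ has a unique strong spin structure, with irreducible real spinor bundle $S=G\times\Sigma$ (trivialized by the left-invariant frame); a left-invariant spinor is a constant map $G\to\Sigma$. It is chiral of chirality $\mu\in\{\pm1\}$ if $\gamma(\nu)\xi=\mu\xi$. Forms act on spinors by $\beta\cdot\xi=\gamma(\Psi(\beta))\xi$, where $\Psi$ is the Chevalley-Riesz isomorphism from forms with the associative geometric product $\theta\diamond\beta=\theta\wedge\beta+\iota_{\theta^\sharp}\beta$ to the Clifford algebra (so for an orthonormal basis, $e^{i_1}\wedge\cdots\wedge e^{i_k}$ with distinct indices acts as $\gamma(e^{i_1})\cdots\gamma(e^{i_k})$).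 $\nabla^S$ is the lift of the Levi-Civita connection to $S$ and $\nabla^{S,H}_X\xi=\nabla^S_X\xi+\frac14(\iota_XH)\cdot\xi$ is the metric connection with totally skew-symmetric torsion $H$. *)

(* Defs.v *)
From HB Require Import structures.
From mathcomp Require Import all_boot all_order all_algebra.
From mathcomp Require Import reals ring.

Set Implicit Arguments.
Unset Strict Implicit.
Unset Printing Implicit Defensive.

Import Order.TTheory GRing.Theory Num.Theory.
Local Open Scope ring_scope.

(* Conventions.  The Lie algebra g is R^4, as column vectors in the basis
   e_1, ..., e_4; its dual is the space of row vectors, with dual basis
   e^i = delta_mx 0 i.  Indices in 'I_4 are zero-based, so that i1, ..., i4
   below are the indices written 1, ..., 4 on paper.  Left-invariant tensors and
   spinors on the simply connected group are represented by their constant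
   values in the left-invariant frame. *)
Definition i1 : 'I_4 := @Ordinal 4 0 isT.
Definition i2 : 'I_4 := @Ordinal 4 1 isT.
Definition i3 : 'I_4 := @Ordinal 4 2 isT.
Definition i4 : 'I_4 := @Ordinal 4 3 isT.

Section Defs.
Variable R : realType.
Implicit Types (D P : 'M[R]_3) (x y z : 'cV[R]_4) (theta : 'rV[R]_4).

Definition evec (i : 'I_4) : 'cV[R]_4 := delta_mx i 0.
Definition ecov (i : 'I_4) : 'rV[R]_4 := delta_mx 0 i.

Definition mx3 (s : seq (seq R)) : 'M[R]_3 :=
  \matrix_(i < 3, j < 3) nth 0 (nth [::] s i) j.

(* The bracket of R^3 x|_D R: [u + s e_4, v + t e_4] = s D v - t D u. *)
Definition lie D x y : 'cV[R]_4 :=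
  let u := usubmx (x : 'cV[R]_(3 + 1)) in
  let s := dsubmx (x : 'cV[R]_(3 + 1)) 0 0 in
  let v := usubmx (y : 'cV[R]_(3 + 1)) in
  let t := dsubmx (y : 'cV[R]_(3 + 1)) 0 0 in
  (col_mx (s *: (D *m v) - t *: (D *m u)) 0 : 'cV[R]_(3 + 1)).

Definition non_abelian D := exists x y, lie D x y <> 0.

Definition eta : 'M[R]_4 := diag_mx (\row_(i < 4) (if (i < 2)%N then 1 else -1)).
Definition metric x y : R := (x^T *m eta *m y) 0 0.
Definition dual_metric theta1 theta2 : R :=
  (theta1 *m invmx eta *m theta2^T) 0 0.
Definition flat x : 'rV[R]_4 := x^T *m eta.
Definition sharp theta : 'cV[R]_4 := invmx eta *m theta^T.

(* A k-form is an alternating multilinear function of the k columns of a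
   4 x k matrix. *)
Record ext_form (k : nat) := ExtForm {
  form_val :> 'M[R]_(4, k) -> R;
  form_multilinear : forall (j : 'I_k) (A B C : 'M[R]_(4, k)) (b c : R),
    col j A = b *: col j B + c *: col j C ->
    col' j A = col' j B -> col' j A = col' j C ->
    form_val A = b * form_val B + c * form_val C;
  form_alternating : forall (A : 'M[R]_(4, k)) (i j : 'I_k),
    i != j -> col i A = col j A -> form_val A = 0 }.

Definition contract k x (w : 'M[R]_(4, k.+1) -> R) (X : 'M[R]_(4, k)) : R :=
  w (row_mx x X).

(* For a coframe given by the rows f^1, ..., f^4 of F, this is
   f^{s_1} /\ ... /\ f^{s_k}, with values det (f^{s_a}(x_b)). *)
Definition wedge (F : 'M[R]_4) k (s : k.-tuple 'I_4) (X : 'M[R]_(4, k)) : R :=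
  \det (rowsub (tnth s) (F *m X)).

(* Chevalley-Eilenberg differential:
   dw(x_0, .., x_{k+1}) =
     sum_{i < j} (-1)^{i+j} w([x_i, x_j], .., omit x_i, .., omit x_j, ..).
   As i < j, column i of col' j X is x_i. *)
Definition ce_d D k (w : 'M[R]_(4, k.+1) -> R) (X : 'M[R]_(4, k.+2)) : R :=
  \sum_(j < k.+2) \sum_(i < k.+1 | (i < j)%N)
    (-1) ^+ (i + j) *
    w (row_mx (lie D (col i (col' j X)) (col j X)) (col' i (col' j X))).

Definition ce_closed D k (w : 'M[R]_(4, k.+1) -> R) :=
  forall X, ce_d D w X = 0.

(* Levi-Civita connection on left-invariant vector fields (Koszul formula); see
   nabla_torsion_free and nabla_metric. *)
Definition koszul D x y z : R :=
  metric (lie D x y) z - metric (lie D y z) x + metric (lie D z x) y.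
Definition nabla D x y : 'cV[R]_4 :=
  sharp (\row_a (2^-1 * koszul D x y (evec a))).

Section Spinors.
Variable gamma : {linear 'rV[R]_4 -> 'M[R]_4}.

(* By the universal property, a module R^4 of Cl(g*, g^* ) is a linear map
   gamma with gamma(theta)^2 = g^*(theta, theta); it acts on columns, hence the
   transposes in the row-space predicate stablemx. *)
Definition clifford_module :=
  forall theta, gamma theta *m gamma theta = (dual_metric theta theta)%:M.
Definition irreducible_module :=
  forall U : 'M[R]_4, (forall theta, stablemx U (gamma theta)^T) ->
    U = 0 \/ row_full U.

(* gamma o Psi on k-forms, in the orthonormal basis e^1, ..., e^4:
   sum_{s_1 < .. < s_k} w(e_{s_1}, .., e_{s_k}) gamma(e^{s_1}) .. gamma(e^{s_k}). *)
Definition form_action k (w : 'M[R]_(4, k) -> R) : 'M[R]_4 :=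
  \sum_(s : k.-tuple 'I_4 | sorted ltn (map val s))
    w (colsub (tnth s) 1%:M) *: \prod_(i <- s) gamma (ecov i).

Definition vol : 'M[R]_(4, 4) -> R := wedge 1%:M [tuple i1; i2; i3; i4].

Definition chiral (mu : R) (xi : 'cV[R]_4) := form_action vol *m xi = mu *: xi.

(* Lift of nabla to constant spinors,
     1/4 sum_{a,b} g(nabla_x e_b, e_a) gamma(e^a) gamma(e^b).
   With gamma(theta)^2 = +g^*(theta, theta) the sign is the one that makes
   Clifford multiplication parallel, see spin_nabla_leibniz. *)
Definition spin_nabla D x : 'M[R]_4 :=
  4^-1 *: \sum_(b < 4) gamma (flat (nabla D x (evec b))) *m gamma (ecov b).

Definition spin_nabla_torsion D (H : ext_form 3) x (xi : 'cV[R]_4) : 'cV[R]_4 :=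
  spin_nabla D x *m xi + 4^-1 *: (form_action (contract x H) *m xi).

End Spinors.

(* The columns of frame P are the basis (f_1, f_2, f_3, e_4), where the columns
   of P are f_1, f_2, f_3; the rows of its inverse are the dual basis. *)
Definition frame P : 'M[R]_4 := (block_mx P 0 0 1%:M : 'M[R]_(3 + 1)).

Definition adapted_basis P :=
  0 < \det P /\ (frame P)^T *m eta *m frame P = eta.

(* f^{s_1} /\ ... /\ f^{s_k} for the basis dual to (f_1, f_2, f_3, e_4). *)
Definition fwedge P k (s : k.-tuple 'I_4) : 'M[R]_(4, k) -> R :=
  wedge (invmx (frame P)) s.

(* Matrix of ad(e_4) on h in the basis given by the columns of P. *)
Definition ad_matrix D P : 'M[R]_3 := invmx P *m D *m P.

Lemma eta_sq : eta *m eta = 1%:M.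
Proof.
rewrite /eta mulmx_diag; apply/matrixP=> i j; rewrite !mxE.
by case: ifP => _; rewrite ?mulrNN mulr1.
Qed.

Lemma eta_unit : eta \in unitmx.
Proof. by case: (mulmx1_unit eta_sq). Qed.

Lemma eta_inv : invmx eta = eta.
Proof.
by rewrite -[LHS]mulmx1 -eta_sq mulmxA mulVmx ?mul1mx // eta_unit.
Qed.

Lemma eta_sym : eta^T = eta. Proof. exact: tr_diag_mx. Qed.

Lemma metricC x y : metric x y = metric y x.
Proof.
have -> : metric x y = (x^T *m eta *m y)^T 0 0 by rewrite [RHS]mxE.
by rewrite !trmx_mul trmxK eta_sym mulmxA.
Qed.

Lemma metricDl x y z : metric (x + y) z = metric x z + metric y z.
Proof. by rewrite /metric linearD !mulmxDl mxE. Qed.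

Lemma metricZl a x z : metric (a *: x) z = a * metric x z.
Proof. by rewrite /metric linearZ -!scalemxAl mxE. Qed.

Lemma metricDr x y z : metric z (x + y) = metric z x + metric z y.
Proof. by rewrite metricC metricDl -!(metricC z). Qed.

Lemma metricZr a x z : metric z (a *: x) = a * metric z x.
Proof. by rewrite metricC metricZl metricC. Qed.

Lemma metricNl x z : metric (- x) z = - metric x z.
Proof. by rewrite -scaleN1r metricZl mulN1r. Qed.

Lemma metric0l z : metric 0 z = 0.
Proof. by rewrite -(scale0r 0) metricZl mul0r. Qed.

Lemma metric_suml (F : 'I_4 -> 'cV[R]_4) z :
  metric (\sum_i F i) z = \sum_i metric (F i) z.
Proof.
exact: (big_morph (metric^~ z) (fun x y => metricDl x y z) (metric0l z)).
Qed.

Lemma metric_evec x (a : 'I_4) : metric x (evec a) = (flat x) 0 a.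
Proof. by rewrite /metric /evec -colE mxE. Qed.

Lemma vec_sum x : x = \sum_a x a 0 *: evec a.
Proof.
apply/matrixP=> i j; rewrite ord1 summxE (bigD1 i) //= big1 ?addr0 => [|k ki].
  by rewrite !mxE !eqxx mulr1.
by rewrite !mxE eq_sym (negbTE ki) mulr0.
Qed.

Lemma metric_sumr x y : metric x y = \sum_a y a 0 * metric x (evec a).
Proof.
rewrite metricC {1}(vec_sum y) metric_suml.
by apply: eq_bigr => a _; rewrite metricZl metricC.
Qed.

Lemma flat_sharp theta : flat (sharp theta) = theta.
Proof.
by rewrite /flat /sharp eta_inv trmx_mul trmxK eta_sym -mulmxA eta_sq mulmx1.
Qed.

Lemma sharp_flat x : sharp (flat x) = x.
Proof.
by rewrite /flat /sharp eta_inv trmx_mul trmxK eta_sym mulmxA eta_sq mul1mx.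
Qed.

Lemma metric_inj x y : (forall z, metric x z = metric y z) -> x = y.
Proof.
move=> h; rewrite -[x]sharp_flat -[y]sharp_flat; congr sharp.
by apply/rowP=> a; rewrite -!metric_evec.
Qed.

Lemma lieDl D x y z : lie D (x + y) z = lie D x z + lie D y z.
Proof.
apply: (etrans _ (esym (@add_col_mx R 3 1 1 _ _ _ _))); congr col_mx; last by rewrite addr0.
rewrite !linearD /= [X in X *: _]mxE scalerDl addrACA.
by [].
Qed.

Lemma lieZl D a x z : lie D (a *: x) z = a *: lie D x z.
Proof.
apply: (etrans _ (esym (@scale_col_mx R 3 1 1 _ _ _))); congr col_mx; last by rewrite scaler0.
rewrite !linearZ /= [X in X *: _]mxE -scalerA.
by rewrite scalerDr; congr (_ + _); rewrite !scalerA mulrC.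
Qed.

Lemma lieN D x y : lie D x y = - lie D y x.
Proof.
apply: (etrans _ (esym (@opp_col_mx R 3 1 1 _ _))); congr col_mx; last by rewrite oppr0.
by rewrite opprB.
Qed.

Lemma lieDr D x y z : lie D z (x + y) = lie D z x + lie D z y.
Proof. by rewrite lieN lieDl opprD -!lieN. Qed.

Lemma lieZr D a x z : lie D z (a *: x) = a *: lie D z x.
Proof. by rewrite lieN lieZl -scalerN -lieN. Qed.

Lemma lie_jacobi D x y z :
  lie D x (lie D y z) + lie D y (lie D z x) + lie D z (lie D x y) = 0.
Proof.
suff E u v w : lie D u (lie D v w) = (col_mx
    ((dsubmx (u : 'cV[R]_(3 + 1)) 0 0 * dsubmx (v : 'cV[R]_(3 + 1)) 0 0)
       *: (D *m (D *m usubmx (w : 'cV[R]_(3 + 1))))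
   - (dsubmx (u : 'cV[R]_(3 + 1)) 0 0 * dsubmx (w : 'cV[R]_(3 + 1)) 0 0)
       *: (D *m (D *m usubmx (v : 'cV[R]_(3 + 1))))) 0 : 'cV[R]_(3 + 1)).
  rewrite !E; apply: (etrans (congr1 (fun t => t + _) (@add_col_mx R 3 1 1 _ _ _ _))).
  apply: (etrans (@add_col_mx R 3 1 1 _ _ _ _)).
  rewrite !addr0 -[RHS](@col_mx0 _ 3 1 1); congr col_mx.
  set a := dsubmx _ 0 0; set b := dsubmx _ 0 0; set c := dsubmx _ 0 0.
  by apply/matrixP=> i j; rewrite !mxE; ring.
rewrite {1}/lie /= /lie /= col_mxKu col_mxKd.
rewrite [X in _ - X *: _]mxE scale0r subr0.
apply: (congr1 (fun t => @col_mx R 3 1 1 t 0)).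
by rewrite mulmxBr -!scalemxAr scalerBr !scalerA.
Qed.

Lemma metric_nabla D x y z : metric (nabla D x y) z = 2^-1 * koszul D x y z.
Proof.
have kD : koszul D x y z = \sum_a z a 0 * koszul D x y (evec a).
  have add u v : koszul D x y (u + v) = koszul D x y u + koszul D x y v.
    by rewrite /koszul lieDr lieDl !metricDl metricDr; ring.
  have sc a u : koszul D x y (a *: u) = a * koszul D x y u.
    by rewrite /koszul lieZr lieZl !metricZl metricZr; ring.
  have k0 : koszul D x y 0 = 0 by rewrite -(scale0r 0) sc mul0r.
  rewrite {1}(vec_sum z) (big_morph (koszul D x y) add k0).
  by apply: eq_bigr => a _; rewrite sc.
rewrite kD metric_sumr mulr_sumr; apply: eq_bigr => a _.
by rewrite metric_evec flat_sharp mxE mulrCA.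
Qed.

Lemma nabla_torsion_free D x y : nabla D x y - nabla D y x = lie D x y.
Proof.
apply: metric_inj => z; rewrite metricDl metricNl !metric_nabla /koszul.
rewrite (lieN D y x) (lieN D z y) (lieN D x z) !metricNl.
by field.
Qed.

Lemma nabla_metric D x y z :
  metric (nabla D x y) z + metric y (nabla D x z) = 0.
Proof.
rewrite [X in _ + X]metricC !metric_nabla /koszul.
rewrite (lieN D y x) (lieN D z y) (lieN D x z) !metricNl.
by ring.
Qed.

Lemma nabla_sum D x y : nabla D x y = \sum_b y b 0 *: nabla D x (evec b).
Proof.
apply: metric_inj => z; rewrite metric_suml.
have -> : metric (nabla D x y) z = - metric y (nabla D x z).
  by apply/eqP; rewrite -addr_eq0 nabla_metric.
rewrite metricC metric_sumr -sumrN; apply: eq_bigr => b _.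
rewrite metricZl -mulrN; congr (_ * _); apply/eqP.
by rewrite eq_sym -addr_eq0 [X in _ + X]metricC nabla_metric.
Qed.

Lemma clifford_polar (gamma : {linear 'rV[R]_4 -> 'M[R]_4}) :
  clifford_module gamma -> forall theta1 theta2,
  gamma theta1 *m gamma theta2 =
    (2 * dual_metric theta1 theta2)%:M - gamma theta2 *m gamma theta1.
Proof.
move=> hg t1 t2; have := hg (t1 + t2).
rewrite linearD /= mulmxDl !mulmxDr !hg => E.
have sym : dual_metric t2 t1 = dual_metric t1 t2.
  rewrite /dual_metric eta_inv.
  have -> : (t1 *m eta *m t2^T) 0 0 = (t1 *m eta *m t2^T)^T 0 0.
    by rewrite [RHS]mxE.
  by rewrite !trmx_mul trmxK eta_sym mulmxA.
have DE : dual_metric (t1 + t2) (t1 + t2) =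
    dual_metric t1 t1 + 2 * dual_metric t1 t2 + dual_metric t2 t2.
  rewrite -(addrA (dual_metric t1 t1)) mulr2n mulrDl mul1r -{2}sym.
  by rewrite /dual_metric linearD /= !mulmxDl !mulmxDr !mxE; ring.
have sM a b : (a + b)%:M = a%:M + b%:M :> 'M[R]_4 by rewrite raddfD.
rewrite DE !sM -!addrA in E; move/addrI: E; rewrite addrCA !addrA => /addIr E.
by apply/eqP; rewrite eq_sym subr_eq addrC E.
Qed.

(* Clifford multiplication is parallel: the commutator of spin_nabla D x with
   gamma(z^flat) is gamma((nabla_x z)^flat). *)
Lemma spin_nabla_leibniz (gamma : {linear 'rV[R]_4 -> 'M[R]_4}) :
  clifford_module gamma -> forall D x z,
  spin_nabla gamma D x *m gamma (flat z) - gamma (flat z) *m spin_nabla gamma D x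
    = gamma (flat (nabla D x z)).
Proof.
move=> hg D x z.
have flatE y : flat y = \sum_b metric y (evec b) *: ecov b.
  apply/rowP=> b; rewrite summxE (bigD1 b) //= big1 ?addr0 => [|c cb].
    by rewrite !mxE !eqxx mulr1 metric_evec mxE.
  by rewrite !mxE !eqxx eq_sym (negbTE cb) mulr0.
have dualE y w : dual_metric (flat y) (flat w) = metric y w.
  rewrite /dual_metric /flat eta_inv trmx_mul trmxK eta_sym.
  by rewrite -(mulmxA y^T) eta_sq mulmx1 mulmxA.
have dual_ecov (b : 'I_4) : dual_metric (ecov b) (flat z) = z b 0.
  by rewrite /dual_metric -mulmxA -/(sharp (flat z)) sharp_flat -rowE mxE.
have step (b : 'I_4) : let n := flat (nabla D x (evec b)) in
    gamma n *m gamma (ecov b) *m gamma (flat z)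
      - gamma (flat z) *m (gamma n *m gamma (ecov b)) =
    (2 * z b 0) *: gamma n
      + (2 * metric (nabla D x z) (evec b)) *: gamma (ecov b).
  move=> n; rewrite -mulmxA (clifford_polar hg (ecov b)) dual_ecov mulmxBr.
  rewrite mul_mx_scalar (mulmxA (gamma n)) (clifford_polar hg n) dualE mulmxBl mul_scalar_mx.
  rewrite opprB -!addrA; congr (_ + _).
  rewrite mulmxA addrCA subrr addr0 -scaleNr; congr (_ *: _).
  rewrite -mulrN; congr (_ * _); apply/eqP; rewrite eq_sym -addr_eq0 addrC.
  by rewrite [X in _ + X]metricC nabla_metric.
rewrite /spin_nabla -scalemxAl -scalemxAr mulmx_suml mulmx_sumr -scalerBr -sumrB.
under eq_bigr do rewrite step.
rewrite big_split /=.
have -> : \sum_b (2 * z b 0) *: gamma (flat (nabla D x (evec b))) =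
    2 *: gamma (flat (nabla D x z)).
  rewrite (nabla_sum D x z) /flat linear_sum mulmx_suml linear_sum scaler_sumr.
  by apply: eq_bigr => b _; rewrite /= linearZ -scalemxAl linearZ scalerA.
have -> : \sum_b (2 * metric (nabla D x z) (evec b)) *: gamma (ecov b) =
    2 *: gamma (flat (nabla D x z)).
  rewrite [in RHS]flatE linear_sum scaler_sumr.
  by apply: eq_bigr => b _; rewrite linearZ scalerA.
rewrite -scalerDl scalerA.
have -> : 4^-1 * (2 + 2) = 1 :> R by field.
by rewrite scale1r.
Qed.

(* ad(e_4) f_j = sum_i (ad_matrix D P)_{ij} f_i, for f_j = frame P e_j. *)
Lemma ad_matrixE D P (v : 'cV[R]_3) : 0 < \det P ->
  lie D (evec i4) (frame P *m (col_mx v 0 : 'cV[R]_(3 + 1))) =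
    frame P *m (col_mx (ad_matrix D P *m v) 0 : 'cV[R]_(3 + 1)).
Proof.
move=> hP; have uP : P \in unitmx by rewrite unitmxE unitfE gt_eqF.
rewrite /frame /ad_matrix.
have E w : (block_mx P 0 0 1%:M : 'M[R]_(3 + 1)) *m (col_mx w 0 : 'cV[R]_(3 + 1))
    = col_mx (P *m w) 0.
  by rewrite mul_block_col !mul0mx !mulmx0 !addr0.
rewrite [X in lie _ _ X]E [RHS]E /lie /= col_mxKu col_mxKd.
apply: (congr1 (fun t => @col_mx R 3 1 1 t 0)).
have -> : dsubmx (evec i4 : 'cV[R]_(3 + 1)) 0 0 = 1.
  by rewrite !mxE; have -> : rshift 3 (0 : 'I_1) = i4 by apply/val_inj.
by rewrite scale1r [X in _ - X *: _]mxE scale0r subr0 -!mulmxA (mulKVmx uP).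
Qed.

End Defs.

(* Main.v *)
Require Import Defs.
From mathcomp Require Import all_boot all_order all_fingroup all_algebra.
From mathcomp Require Import reals ring lra.

Import Order.TTheory GRing.Theory Num.Theory.
Local Open Scope ring_scope.

(** A non-zero spinor [xi] of chirality 1 in signature (2,2) is pure: the
    covectors that annihilate it under Clifford multiplication form a null
    plane.  A rotation of the plane of [e_1, e_2] brings this plane to the span
    of [e^2 + e^3] and [e^1 + e^4] ([chiral_frame]), so that after a change of
    basis of the ideal
      [e^3 xi = - e^2 xi] and [e^4 xi = - e^1 xi]   ([null_spinor]).
    Conversely, every adapted basis has such a spinor, and it has chirality 1
    ([null_exists], [null_chiral]).

    In such a basis the spinorial equations become linear.  As [e^1 e^2] squares
    to -1, [xi] and [e^1 e^2 xi] are independent, and so are [e^1 xi] and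
    [e^2 xi] ([indep_e12]); by purity every form sends [xi] to an explicit
    combination of these four spinors.  The spin connection along [x] is a
    quarter of the action of the 2-form with components
    [koszul x e_b e_a] ([spin_nabla_koszul]), and adding the torsion leaves two
    equations for each [x] ([torsion_null]), that is eight linear equations in
    the nine entries of [D] and the four components of [H] ([torsion_system]).
    They are solved by the family of the theorem.  The equation
    [phi . xi = H . xi] determines two components of [phi].  The remaining
    quadratic conditions say that the forms are closed: [d phi = 0] means that
    [phi] vanishes on the image of [D] ([ce_closed1]) and [d H = 0] means
    [H_123 Tr D = 0] ([ce_closed3]).

    All the objects are natural under a change of adapted basis, once Clifford
    multiplication is transported along ([frame_gamma]).  For the action of
    forms, defined by increasing products in one orthonormal basis, this is
    [form_action_frame]; for chirality it uses that the basis is oriented. *)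

Set Implicit Arguments.
Unset Strict Implicit.
Unset Printing Implicit Defensive.

(** * Exterior forms in coordinates *)

Lemma ord4_cases (a : 'I_4) : [\/ a = i1, a = i2, a = i3 | a = i4].
Proof.
by case: a => -[|[|[|[|//]]]] p; [apply: Or41|apply: Or42|apply: Or43|apply: Or44];
  apply: val_inj.
Qed.

Lemma sum4 (V : nmodType) (F : 'I_4 -> V) :
  \sum_(i < 4) F i = F i1 + F i2 + F i3 + F i4.
Proof.
rewrite !big_ord_recl big_ord0 addr0 !addrA.
by congr (F _ + F _ + F _ + F _); apply: val_inj.
Qed.

Lemma sum4_cond (V : nmodType) (P : pred 'I_4) (F : 'I_4 -> V) :
  \sum_(i < 4 | P i) F i =
    (if P i1 then F i1 else 0) + (if P i2 then F i2 else 0)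
    + (if P i3 then F i3 else 0) + (if P i4 then F i4 else 0).
Proof. by rewrite big_mkcond sum4. Qed.

Lemma big_tuple_cons (V : nmodType) (T : finType) k (P : pred (k.+1.-tuple T))
    (F : k.+1.-tuple T -> V) :
  \sum_(s | P s) F s =
  \sum_a \sum_(t : k.-tuple T | P [tuple of a :: t]) F [tuple of a :: t].
Proof.
rewrite pair_big_dep /=.
rewrite (reindex (fun p : T * k.-tuple T => [tuple of p.1 :: p.2])) //=.
exists (fun s => (thead s, behead_tuple s)) => [[a t] _ | s _] /=.
  by rewrite theadE; congr pair; apply: val_inj.
by rewrite [s in RHS]tuple_eta; apply: val_inj.
Qed.

Lemma sum_sorted_cons (V : nmodType) n k (F : k.+1.-tuple 'I_n -> V) :
  \sum_(s : k.+1.-tuple 'I_n | sorted ltn (map val s)) F s =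
  \sum_(a < n) \sum_(t : k.-tuple 'I_n | path ltn (val a) (map val t))
     F [tuple of a :: t].
Proof. by rewrite big_tuple_cons. Qed.

(** Increasing tuples are enumerated one entry at a time, so that the branches
    which cannot be completed are cut before they are expanded. *)
Lemma sum_path_cons (V : nmodType) n k x (F : k.+1.-tuple 'I_n -> V) :
  \sum_(s : k.+1.-tuple 'I_n | path ltn x (map val s)) F s =
  \sum_(a < n | (x < a)%N)
     \sum_(t : k.-tuple 'I_n | path ltn (val a) (map val t)) F [tuple of a :: t].
Proof.
rewrite big_tuple_cons [RHS]big_mkcond; apply: eq_bigr => a _ /=.
by case: ifP => //= xa; rewrite big_pred0.
Qed.

Lemma sum_path0 (V : nmodType) n x (F : 0.-tuple 'I_n -> V) :
  \sum_(s : 0.-tuple 'I_n | path ltn x (map val s)) F s = F [tuple].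
Proof.
rewrite big_mkcond /= (bigD1 [tuple]) //= big1 ?addr0 // => t.
by move/eqP; case; rewrite tuple0.
Qed.

Lemma sum_sorted0 (V : nmodType) n (F : 0.-tuple 'I_n -> V) :
  \sum_(s : 0.-tuple 'I_n | sorted ltn (map val s)) F s = F [tuple].
Proof. by rewrite -(sum_path0 0 F); apply: eq_bigl => s; rewrite tuple0. Qed.

Lemma sum_sorted1 (V : nmodType) (F : 1.-tuple 'I_4 -> V) :
  \sum_(s : 1.-tuple 'I_4 | sorted ltn (map val s)) F s =
  F [tuple i1] + F [tuple i2] + F [tuple i3] + F [tuple i4].
Proof.
rewrite sum_sorted_cons sum4 !sum_path0.
by congr (F _ + F _ + F _ + F _); apply: val_inj.
Qed.

Lemma sum_sorted2 (V : nmodType) (F : 2.-tuple 'I_4 -> V) :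
  \sum_(s : 2.-tuple 'I_4 | sorted ltn (map val s)) F s =
  F [tuple i1; i2] + F [tuple i1; i3] + F [tuple i1; i4]
  + F [tuple i2; i3] + F [tuple i2; i4] + F [tuple i3; i4].
Proof.
rewrite sum_sorted_cons sum4 !sum_path_cons !sum4_cond /= !sum_path0.
rewrite !(addr0, add0r) ?addrA.
by congr (F _ + F _ + F _ + F _ + F _ + F _); apply: val_inj.
Qed.

Lemma sum_sorted3 (V : nmodType) (F : 3.-tuple 'I_4 -> V) :
  \sum_(s : 3.-tuple 'I_4 | sorted ltn (map val s)) F s =
  F [tuple i1; i2; i3] + F [tuple i1; i2; i4] + F [tuple i1; i3; i4]
  + F [tuple i2; i3; i4].
Proof.
rewrite sum_sorted_cons sum4 !sum_path_cons !sum4_cond /=.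
rewrite !sum_path_cons !sum4_cond /= !sum_path0 !(addr0, add0r) ?addrA.
by congr (F _ + F _ + F _ + F _); apply: val_inj.
Qed.

Lemma sum_sorted4 (V : nmodType) (F : 4.-tuple 'I_4 -> V) :
  \sum_(s : 4.-tuple 'I_4 | sorted ltn (map val s)) F s = F [tuple i1; i2; i3; i4].
Proof.
rewrite sum_sorted_cons sum4 !sum_path_cons !sum4_cond /=.
rewrite !sum_path_cons !sum4_cond /= !sum_path_cons !sum4_cond /= !sum_path0.
by rewrite !(addr0, add0r); congr F; apply: val_inj.
Qed.

Section Forms.
Variable R : realType.

(** The columns are [e_l0, e_l1, ...], so that [w (basis_mx k l)] is the
    component of the form [w] with indices [l].  A list rather than a tuple
    keeps explicit index lists free of size proofs. *)
Definition basis_mx k (l : seq 'I_4) : 'M[R]_(4, k) :=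
  \matrix_(i, j) (i == nth i1 l j)%:R.

Lemma colsub_basis k (s : k.-tuple 'I_4) :
  colsub (tnth s) 1%:M = basis_mx k s.
Proof. by apply/matrixP=> i j; rewrite !mxE (tnth_nth i1). Qed.

Lemma form_lin k (w : ext_form R k) j (A B C : 'M[R]_(4, k)) b c :
    (forall i, A i j = b * B i j + c * C i j) ->
    (forall i (l : 'I_k), l != j -> A i l = B i l) ->
    (forall i (l : 'I_k), l != j -> A i l = C i l) ->
  w A = b * w B + c * w C.
Proof.
move=> hj hB hC; apply: (@form_multilinear _ _ w j).
- by apply/matrixP=> i o; rewrite !mxE hj.
- by apply/matrixP=> i l; rewrite !mxE hB // eq_sym neq_lift.
- by apply/matrixP=> i l; rewrite !mxE hC // eq_sym neq_lift.
Qed.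

Lemma form_eqcol k (w : ext_form R k) (A : 'M[R]_(4, k)) (i j : 'I_k) :
  i != j -> (forall l, A l i = A l j) -> w A = 0.
Proof.
by move=> ij h; apply: (@form_alternating _ _ w _ _ _ ij); apply/matrixP=> l o; rewrite !mxE.
Qed.

(** By polarization: [w] vanishes when both columns [i] and [j] are replaced by
    their sum. *)
Lemma form_swap k (w : ext_form R k) (A B : 'M[R]_(4, k)) (i j : 'I_k) : i != j ->
    (forall l, B l i = A l j) -> (forall l, B l j = A l i) ->
    (forall l (m : 'I_k), m != i -> m != j -> B l m = A l m) ->
  w B = - w A.
Proof.
move=> ij hi hj hm.
(* [M a b c d] has [a A_i + b A_j] as column [i] and [c A_i + d A_j] as
   column [j]. *)
pose M (a b : R) (c d : R) : 'M[R]_(4, k) := \matrix_(l, m)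
  if m == i then a * A l i + b * A l j
  else if m == j then c * A l i + d * A l j else A l m.
have ji : (j == i) = false by rewrite eq_sym (negbTE ij).
have E1 a b c d : w (M a b c d) = a * w (M 1 0 c d) + b * w (M 0 1 c d).
  apply: (form_lin w (j := i)) => [l|l m mi|l m mi]; rewrite !mxE ?eqxx ?(negbTE mi) //.
  by ring.
have E2 a b c d : w (M a b c d) = c * w (M a b 1 0) + d * w (M a b 0 1).
  apply: (form_lin w (j := j)) => [l|l m mi|l m mi]; rewrite !mxE ?eqxx ?ji ?(negbTE mi) //.
  by ring.
have Z a b : w (M a b a b) = 0.
  by apply: (form_eqcol w ij) => l; rewrite !mxE ji !eqxx.
have -> : A = M 1 0 0 1.
  apply/matrixP=> l m; rewrite mxE; case: eqP => [->|_]; first by ring.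
  by case: eqP => [->|_]; first by ring.
have -> : B = M 0 1 1 0.
  apply/matrixP=> l m; rewrite mxE; case: eqP => [->|/eqP mi]; first by rewrite hi mul0r mul1r add0r.
  by case: eqP => [->|/eqP mj]; [rewrite hj mul0r mul1r addr0 | rewrite hm].
have := Z 1 1; rewrite E1 (E2 1 0) (E2 0 1) !Z => h.
by apply/eqP; rewrite -addr_eq0; apply/eqP; apply: etrans h; ring.
Qed.

Lemma row_mx1E k (x : 'cV[R]_4) (X : 'M[R]_(4, k)) i (j : 'I_k.+1) :
  row_mx x X i j = if unlift ord0 j is Some l then X i l else x i 0.
Proof.
case: unliftP => [l ->|->].
  have -> : lift ord0 l = rshift 1 l by apply: val_inj.
  exact: row_mxEr.
have -> : ord0 = lshift k 0 :> 'I_(1 + k) by apply: val_inj.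
exact: row_mxEl.
Qed.

Lemma contract_multilinear k x (w : ext_form R k.+1) :
  forall (j : 'I_k) (A B C : 'M[R]_(4, k)) (b c : R),
    col j A = b *: col j B + c *: col j C ->
    col' j A = col' j B -> col' j A = col' j C ->
    contract x w A = b * contract x w B + c * contract x w C.
Proof.
move=> j A B C b c hj hB hC; rewrite /contract.
have E (M N : 'M[R]_(4, k)) : col' j M = col' j N ->
    forall i (l : 'I_k.+1), l != lift ord0 j -> row_mx x M i l = row_mx x N i l.
  move=> h i l; rewrite !row_mx1E; case: unliftP => // m -> /eqP lm.
  case: (unliftP j m) => [n ->|mj]; last by case: lm; rewrite mj.
  by move/matrixP: h => /(_ i n); rewrite !mxE.
apply: (form_lin w (j := lift ord0 j)); [|exact: E|exact: E].
move=> i; rewrite !row_mx1E liftK.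
by move/matrixP: hj => /(_ i 0); rewrite !mxE.
Qed.

Lemma contract_alternating k x (w : ext_form R k.+1) :
  forall (A : 'M[R]_(4, k)) (i j : 'I_k),
    i != j -> col i A = col j A -> contract x w A = 0.
Proof.
move=> A i j ij h; apply: (form_eqcol w (i := lift ord0 i) (j := lift ord0 j)).
  by rewrite (inj_eq lift_inj).
move=> l; rewrite !row_mx1E !liftK.
by move/matrixP: h => /(_ l 0); rewrite !mxE.
Qed.

Definition contract_form k x (w : ext_form R k.+1) : ext_form R k :=
  ExtForm (@contract_multilinear k x w) (@contract_alternating k x w).

Lemma contract_sum k (w : ext_form R k.+1) (x : 'cV[R]_4) X :
  contract x w X = \sum_a x a 0 * contract (evec R a) w X.
Proof.
have Z (y : 'cV[R]_4) : contract (0 *: y) w X = 0.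
  rewrite /contract (form_lin w (j := ord0) (b := 0) (c := 0)
    (B := row_mx y X) (C := row_mx y X)) ?mul0r ?addr0 //.
  - by move=> i; rewrite !row_mx1E unlift_none !mxE; ring.
  - by move=> i l; rewrite !row_mx1E; case: unliftP => // ->; rewrite eqxx.
  - by move=> i l; rewrite !row_mx1E; case: unliftP => // ->; rewrite eqxx.
have D b c (y z : 'cV[R]_4) : contract (b *: y + c *: z) w X =
    b * contract y w X + c * contract z w X.
  apply: (form_lin w (j := ord0)).
  - by move=> i; rewrite !row_mx1E unlift_none !mxE.
  - by move=> i l; rewrite !row_mx1E; case: unliftP => // ->; rewrite eqxx.
  - by move=> i l; rewrite !row_mx1E; case: unliftP => // ->; rewrite eqxx.
have add y z : contract (y + z) w X = contract y w X + contract z w X.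
  by have := D 1 1 y z; rewrite !scale1r !mul1r.
have c0 : contract 0 w X = 0 by rewrite -(scale0r 0) Z.
rewrite {1}(vec_sum x) (big_morph (fun y => contract y w X) add c0).
apply: eq_bigr => a _.
by have := D (x a 0) 0 (evec R a) 0; rewrite scale0r addr0 mul0r addr0.
Qed.

Lemma contract_basis k (w : ext_form R k.+1) a l :
  contract (evec R a) w (basis_mx k l) = w (basis_mx k.+1 (a :: l)).
Proof.
rewrite /contract; congr (w _); apply/matrixP=> i j; rewrite row_mx1E !mxE.
by case: unliftP => [m ->|->] /=; rewrite ?mxE ?eqxx ?andbT.
Qed.

Lemma pullback_multilinear k (F : 'M[R]_4) (w : ext_form R k) :
  forall (j : 'I_k) (A B C : 'M[R]_(4, k)) (b c : R),
    col j A = b *: col j B + c *: col j C ->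
    col' j A = col' j B -> col' j A = col' j C ->
    w (F *m A) = b * w (F *m B) + c * w (F *m C).
Proof.
move=> j A B C b c hj hB hC; apply: (@form_multilinear _ _ w j).
- by rewrite !colE -!mulmxA -!colE hj mulmxDr !scalemxAr.
- by rewrite !col'Esub -!mulmx_colsub -!col'Esub hB.
- by rewrite !col'Esub -!mulmx_colsub -!col'Esub hC.
Qed.

Lemma pullback_alternating k (F : 'M[R]_4) (w : ext_form R k) :
  forall (A : 'M[R]_(4, k)) (i j : 'I_k),
    i != j -> col i A = col j A -> w (F *m A) = 0.
Proof.
move=> A i j ij h; apply: (@form_alternating _ _ w _ _ _ ij).
by rewrite !colE -!mulmxA -!colE h.
Qed.

Definition pullback k (F : 'M[R]_4) (w : ext_form R k) : ext_form R k :=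
  ExtForm (@pullback_multilinear k F w) (@pullback_alternating k F w).

Lemma wedge_multilinear k (F : 'M[R]_4) (s : k.-tuple 'I_4) :
  forall (j : 'I_k) (A B C : 'M[R]_(4, k)) (b c : R),
    col j A = b *: col j B + c *: col j C ->
    col' j A = col' j B -> col' j A = col' j C ->
    wedge F s A = b * wedge F s B + c * wedge F s C.
Proof.
move=> j A B C b c hj hB hC; rewrite /wedge.
rewrite -(det_tr (rowsub _ (F *m A))) -(det_tr (rowsub _ (F *m B))).
rewrite -(det_tr (rowsub _ (F *m C))).
have E (M : 'M[R]_(4, k)) : rowsub (tnth s) (F *m M) = rowsub (tnth s) F *m M.
  by rewrite -mul_rowsub_mx.
rewrite !E; apply: (determinant_multilinear (i0 := j)).
- by rewrite -!tr_col !colE -!mulmxA -!colE hj mulmxDr -!scalemxAr linearD !linearZ.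
- by rewrite -!tr_col' !col'Esub -!mulmx_colsub -!col'Esub hB.
- by rewrite -!tr_col' !col'Esub -!mulmx_colsub -!col'Esub hC.
Qed.

Lemma wedge_alternating k (F : 'M[R]_4) (s : k.-tuple 'I_4) :
  forall (A : 'M[R]_(4, k)) (i j : 'I_k),
    i != j -> col i A = col j A -> wedge F s A = 0.
Proof.
move=> A i j ij h; rewrite /wedge -det_tr; apply: (determinant_alternate ij) => l.
rewrite !mxE; apply: eq_bigr => m _; congr (_ * _).
by move/matrixP: h => /(_ m 0); rewrite !mxE.
Qed.

Definition wedge_form k (F : 'M[R]_4) (s : k.-tuple 'I_4) : ext_form R k :=
  ExtForm (@wedge_multilinear k F s) (@wedge_alternating k F s).

(** By induction on the degree: expand the first column and contract with the
    basis vectors. *)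
Lemma form_eq_all k (w1 w2 : ext_form R k) :
  (forall s : k.-tuple 'I_4, w1 (basis_mx k s) = w2 (basis_mx k s)) -> w1 =1 w2.
Proof.
elim: k w1 w2 => [|k IH] w1 w2 h X.
  by have := h [tuple]; rewrite (thinmx0 X) (thinmx0 (basis_mx _ _)).
have E (w : ext_form R k.+1) : w X =
    contract (lsubmx (X : 'M[R]_(4, 1 + k))) w (rsubmx (X : 'M[R]_(4, 1 + k))).
  by rewrite /contract hsubmxK.
rewrite !E (contract_sum w1) (contract_sum w2); apply: eq_bigr => a _; congr (_ * _).
apply: (IH (contract_form (evec R a) w1) (contract_form (evec R a) w2)) => s.
by rewrite /= !contract_basis; apply: (h [tuple of a :: s]).
Qed.

End Forms.

Section Basis.
Variable R : realType.

(** Sorting the indices is a product of transpositions, each of which changes the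
    sign of both forms; components with a repeated index vanish. *)
Lemma form_eq_sorted k (w1 w2 : ext_form R k) :
    (forall s : k.-tuple 'I_4, sorted ltn (map val s) ->
       w1 (basis_mx R k s) = w2 (basis_mx R k s)) ->
  w1 =1 w2.
Proof.
move=> h; apply: form_eq_all => s.
case: (boolP (uniq s)) => [us|].
  pose r := fun a b : 'I_4 => (val a <= val b)%N.
  pose t := [tuple of sort r s].
  have st : sorted ltn (map val t).
    rewrite ltn_sorted_uniq_leq map_inj_uniq; last exact: val_inj.
    rewrite sort_uniq us sorted_map; apply: sort_sorted => a b; exact: leq_total.
  have : perm_eq s t by rewrite perm_sym perm_sort.
  case/tuple_permP=> p Ep.
  have -> : basis_mx R k s = colsub (fun i => tnth t (p i)) 1%:M.
    apply/matrixP=> i j; rewrite !mxE Ep -tnth_nth.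
    by congr (_ == _)%:R; rewrite tnth_mktuple.
  have [ts -> _] := prod_tpermP p.
  elim: ts => [|[a b] ts IH].
    rewrite big_nil.
    have -> : colsub (fun i => tnth t ((1%g : {perm 'I_k}) i)) 1%:M = basis_mx R k t.
      by apply/matrixP=> i j; rewrite !mxE perm1 (tnth_nth i1).
    exact: h.
  rewrite big_cons /=; set q := (\prod_(j <- ts) _)%g in IH *.
  case: (eqVneq a b) => [->|ab]; first by rewrite tperm1 mul1g.
  have E (w : ext_form R k) :
      w (colsub (fun i => tnth t ((tperm a b * q)%g i)) 1%:M) =
      - w (colsub (fun i => tnth t (q i)) 1%:M).
    apply: (form_swap w ab) => [l|l|l m ma mb]; rewrite !mxE permM.
    - by rewrite tpermL.
    - by rewrite tpermR.
    - by rewrite tpermD // eq_sym.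
  by rewrite !E IH.
move/(uniqPn i1) => [i [j [ij js e]]].
have ks := size_tuple s; rewrite ks in js.
have lt_ik := ltn_trans ij js.
have Z (w : ext_form R k) : w (basis_mx R k s) = 0.
  apply: (@form_eqcol _ _ w _ (Ordinal lt_ik) (Ordinal js)).
    by rewrite -val_eqE /= ltn_eqF.
  by move=> l; rewrite !mxE /= e.
by rewrite !Z.
Qed.

Lemma sorted_tuple_uniq k (s : k.-tuple 'I_4) :
  sorted ltn (map val s) -> uniq s.
Proof.
by rewrite -(map_inj_uniq val_inj) => /(sorted_uniq ltn_trans ltnn).
Qed.

Lemma sorted_tuple_sub k (s t : k.-tuple 'I_4) :
  sorted ltn (map val s) -> sorted ltn (map val t) ->
  {subset s <= t} -> s = t.
Proof.
move=> hs ht st.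
have us := sorted_tuple_uniq hs.
have [_ est] := uniq_min_size us st (eq_leq (etrans (size_tuple t) (esym (size_tuple s)))).
apply: val_inj; apply: (inj_map val_inj).
apply: (irr_sorted_eq ltn_trans ltnn hs ht) => x.
apply/mapP/mapP => -[y ys ->]; exists y => //; by rewrite ?est // -est.
Qed.

Lemma wedge_basis k (s t : k.-tuple 'I_4) :
  sorted ltn (map val s) -> sorted ltn (map val t) ->
  wedge 1%:M s (basis_mx R k t) = (s == t)%:R.
Proof.
move=> hs ht; rewrite /wedge mul1mx.
case: eqP => [->|st].
  suff -> : rowsub (tnth t) (basis_mx R k t) = 1%:M by rewrite det1.
  apply/matrixP=> i j; rewrite !mxE -tnth_nth.
  by rewrite (inj_eq (tuple_uniqP _ (sorted_tuple_uniq ht))).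
have [/allP /(sorted_tuple_sub hs ht)//|] := boolP (all (mem t) s).
(* An index of [s] that is not in [t] gives a row of zeros. *)
case/allPn=> a /tnthP[i ->] ait.
rewrite (expand_det_row _ i) big1 // => j _; rewrite !mxE -tnth_nth.
case: eqP => [e|_]; last by rewrite mul0r.
by case/negP: ait; rewrite e; apply: mem_tnth.
Qed.

Lemma sum_multilinear k (I : finType) (P : pred I) (c : I -> R)
    (W : I -> ext_form R k) :
  forall (j : 'I_k) (A B C : 'M[R]_(4, k)) (b d : R),
    col j A = b *: col j B + d *: col j C ->
    col' j A = col' j B -> col' j A = col' j C ->
    \sum_(s | P s) c s * W s A =
    b * (\sum_(s | P s) c s * W s B) + d * (\sum_(s | P s) c s * W s C).
Proof.
move=> j A B C b d hj hB hC; rewrite !mulr_sumr -big_split.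
by apply: eq_bigr => s _; rewrite (form_multilinear (W s) hj hB hC) /=; ring.
Qed.

Lemma sum_alternating k (I : finType) (P : pred I) (c : I -> R)
    (W : I -> ext_form R k) :
  forall (A : 'M[R]_(4, k)) (i j : 'I_k),
    i != j -> col i A = col j A -> \sum_(s | P s) c s * W s A = 0.
Proof.
move=> A i j ij h; apply: big1 => s _.
by rewrite (form_alternating (W s) ij h) mulr0.
Qed.

Lemma form_expand k (w : ext_form R k) X :
  w X = \sum_(s : k.-tuple 'I_4 | sorted ltn (map val s))
    w (basis_mx R k s) * wedge 1%:M s X.
Proof.
pose P (s : k.-tuple 'I_4) := sorted ltn (map val s).
pose c (s : k.-tuple 'I_4) := w (basis_mx R k s).
pose W (s : k.-tuple 'I_4) := wedge_form 1%:M s : ext_form R k.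
apply: (@form_eq_sorted k w
  (ExtForm (@sum_multilinear k _ P c W) (@sum_alternating k _ P c W))) => t ht /=.
rewrite (bigD1 t) //= wedge_basis // eqxx mulr1 big1 ?addr0 // => s /andP[hs st].
by rewrite wedge_basis // (negbTE st) mulr0.
Qed.

Lemma form1_expand (w : ext_form R 1) X :
  w X = w (basis_mx R 1 [:: i1]) * wedge 1%:M [tuple i1] X
      + w (basis_mx R 1 [:: i2]) * wedge 1%:M [tuple i2] X
      + w (basis_mx R 1 [:: i3]) * wedge 1%:M [tuple i3] X
      + w (basis_mx R 1 [:: i4]) * wedge 1%:M [tuple i4] X.
Proof.
by rewrite [LHS]form_expand sum_sorted1.
Qed.

Lemma form3_expand (w : ext_form R 3) X :
  w X = w (basis_mx R 3 [:: i1; i2; i3]) * wedge 1%:M [tuple i1; i2; i3] X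
      + w (basis_mx R 3 [:: i1; i2; i4]) * wedge 1%:M [tuple i1; i2; i4] X
      + w (basis_mx R 3 [:: i1; i3; i4]) * wedge 1%:M [tuple i1; i3; i4] X
      + w (basis_mx R 3 [:: i2; i3; i4]) * wedge 1%:M [tuple i2; i3; i4] X.
Proof.
by rewrite [LHS]form_expand sum_sorted3.
Qed.

End Basis.

(** * Change of adapted basis *)

Section Frames.
Variable R : realType.
Variables (P : 'M[R]_3) (hP : adapted_basis P).
Implicit Types (D : 'M[R]_3) (x y z : 'cV[R]_4) (theta : 'rV[R]_4).
Local Notation F := (frame P).

Lemma frame_isometry : F^T *m eta R *m F = eta R.
Proof. by case: hP. Qed.

Lemma frame_unit : F \in unitmx.
Proof.
(* By isometry, [eta F^T eta] is a left inverse of [F]. *)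
have : (eta R *m F^T *m eta R) *m F = 1%:M.
  by rewrite -mulmxA -mulmxA (mulmxA F^T) frame_isometry eta_sq.
by case/mulmx1_unit.
Qed.

Lemma basis_unit : P \in unitmx.
Proof. by case: hP => p _; rewrite unitmxE unitfE gt_eqF. Qed.

Lemma det_frame : \det F = 1.
Proof.
have dF : \det F = \det P.
  by apply: (etrans (@det_ublock R 3 1 P 0 1%:M)); rewrite det1 mulr1.
have dE : \det (eta R) != 0 by rewrite -unitfE -unitmxE eta_unit.
have := congr1 determinant frame_isometry; rewrite !det_mulmx det_tr dF => h.
have : (\det P) ^+ 2 == 1.
  by rewrite -(inj_eq (mulIf dE)) mul1r -{2}h; apply/eqP; ring.
case: hP => p _; rewrite sqrf_eq1 => /orP[/eqP //|/eqP e].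
by rewrite e ltr0N1 in p.
Qed.

Lemma lie_frame D x y : lie D (F *m x) (F *m y) = F *m lie (ad_matrix D P) x y.
Proof.
have E z : (F *m z : 'cV_(3 + 1)) = col_mx (P *m usubmx (z : 'cV_(3 + 1)))
    (dsubmx (z : 'cV_(3 + 1))).
  apply: (etrans (congr1 (mulmx F) (esym (@vsubmxK R 3 1 1 z)))).
  apply: (etrans (@mul_block_col R 3 1 3 1 1 P 0 0 1%:M _ _)).
  by rewrite !mul0mx mul1mx addr0 add0r.
rewrite /lie !E !(@col_mxKu _ 3 1) !(@col_mxKd _ 3 1).
apply: (congr1 (fun t => @col_mx R 3 1 1 t 0)).
by rewrite /ad_matrix mulmxBr -!scalemxAr -!mulmxA !(mulKVmx basis_unit).
Qed.

Lemma metric_frame x y : metric (F *m x) (F *m y) = metric x y.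
Proof.
by rewrite /metric trmx_mul -!mulmxA (mulmxA (eta R)) (mulmxA F^T) (mulmxA F^T)
   frame_isometry mulmxA.
Qed.

Lemma flat_frame x : flat (F *m x) = flat x *m invmx F.
Proof.
apply: (canRL (mulmxK frame_unit)).
by rewrite /flat trmx_mul -!mulmxA (mulmxA F^T) frame_isometry.
Qed.

Lemma nabla_frame D x y :
  nabla D (F *m x) (F *m y) = F *m nabla (ad_matrix D P) x y.
Proof.
apply: metric_inj => z; rewrite -(mulKVmx frame_unit z) metric_frame !metric_nabla.
by rewrite /koszul !lie_frame !metric_frame.
Qed.

Lemma ce_d_frame D k (w : ext_form R k.+1) (X : 'M[R]_(4, k.+2)) :
  ce_d D w (F *m X) = ce_d (ad_matrix D P) (pullback F w) X.
Proof.
apply: eq_bigr => j _; apply: eq_bigr => i _; congr (_ * _).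
rewrite /=; congr (w _); apply: (etrans _ (esym (@mul_mx_row _ 4 4 1 k F _ _))).
rewrite -lie_frame; congr row_mx.
  by rewrite !colE !col'Esub -!mulmx_colsub !mulmxA.
by rewrite !col'Esub -!mulmx_colsub.
Qed.

Lemma ce_closed_frame D k (w : ext_form R k.+1) :
  ce_closed (ad_matrix D P) (pullback F w) <-> ce_closed D w.
Proof.
split=> h X; last by rewrite -ce_d_frame.
by rewrite -(mulKVmx frame_unit X) ce_d_frame.
Qed.

Lemma wedge_frame k (s : k.-tuple 'I_4) X : fwedge P s (F *m X) = wedge 1%:M s X.
Proof. by rewrite /fwedge /wedge (mulKmx frame_unit) mul1mx. Qed.

Variable gamma : {linear 'rV[R]_4 -> 'M[R]_4}.

(** Clifford multiplication as seen in the frame: a covector with coordinates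
    [theta] in the dual basis of [frame P] is [theta *m invmx (frame P)]. *)
Definition frame_gamma : {linear 'rV[R]_4 -> 'M[R]_4} := gamma \o mulmxr (invmx F).

Lemma frame_gammaE theta : frame_gamma theta = gamma (theta *m invmx F).
Proof. by []. Qed.

Lemma frame_clifford : clifford_module gamma -> clifford_module frame_gamma.
Proof.
move=> hg theta; rewrite frame_gammaE hg; congr (_ %:M).
rewrite -[theta](flat_sharp theta) -flat_frame.
have E x y : dual_metric (flat x) (flat y) = metric x y.
  rewrite /dual_metric /flat eta_inv trmx_mul trmxK eta_sym.
  by rewrite -(mulmxA x^T) eta_sq mulmx1 mulmxA.
by rewrite !E metric_frame.
Qed.

Lemma gamma_flat_sum (c : 'I_4 -> R) (v : 'I_4 -> 'cV[R]_4) :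
  gamma (flat (\sum_b c b *: v b)) = \sum_b c b *: gamma (flat (v b)).
Proof.
rewrite /flat linear_sum mulmx_suml linear_sum; apply: eq_bigr => b _.
by rewrite /= linearZ -scalemxAl linearZ.
Qed.

Lemma gamma_ecov_frame b :
  gamma (ecov R b) = \sum_a F b a *: frame_gamma (ecov R a).
Proof.
have -> : ecov R b = (row b F) *m invmx F.
  by rewrite -row_mul mulmxV ?frame_unit // row1.
rewrite [row b F]row_sum_delta mulmx_suml linear_sum; apply: eq_bigr => a _.
by rewrite -scalemxAl linearZ mxE.
Qed.

(** The sum over [b] that defines the spin connection pairs a basis with its dual
    basis, hence it is the same in every basis. *)
Lemma spin_nabla_frame D x :
  spin_nabla gamma D (F *m x) = spin_nabla frame_gamma (ad_matrix D P) x.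
Proof.
rewrite /spin_nabla; congr (_ *: _).
under eq_bigr => b _ do rewrite gamma_ecov_frame mulmx_sumr.
rewrite exchange_big; apply: eq_bigr => a _ /=.
rewrite -flat_frame -nabla_frame nabla_sum gamma_flat_sum mulmx_suml.
apply: eq_bigr => b _; rewrite -scalemxAr -scalemxAl.
by congr (_ *: _); rewrite /evec -colE [RHS]mxE.
Qed.

End Frames.

(** * Clifford action of forms *)

Section FormAction.
Variable R : realType.
Implicit Type gamma : {linear 'rV[R]_4 -> 'M[R]_4}.

Lemma eq_form_action gamma k (w1 w2 : 'M[R]_(4, k) -> R) :
  w1 =1 w2 -> form_action gamma w1 = form_action gamma w2.
Proof. by move=> h; apply: eq_bigr => s _; rewrite h. Qed.

Lemma form_action_basis gamma k (w : 'M[R]_(4, k) -> R) :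
  form_action gamma w = \sum_(s : k.-tuple 'I_4 | sorted ltn (map val s))
    w (basis_mx R k s) *: \prod_(i <- s) gamma (ecov R i).
Proof. by apply: eq_bigr => s _; rewrite colsub_basis. Qed.

Lemma form_action_contract gamma k (w : ext_form R k.+1) (x : 'cV[R]_4) :
  form_action gamma (contract x w) =
  \sum_a x a 0 *: form_action gamma (contract (evec R a) w).
Proof.
under [RHS]eq_bigr => a _ do rewrite scaler_sumr.
rewrite exchange_big; apply: eq_bigr => s _ /=.
by rewrite contract_sum scaler_suml; apply: eq_bigr => a _; rewrite scalerA.
Qed.

Lemma contract_pullback k (F : 'M[R]_4) (w : ext_form R k.+1) x X :
  contract x (pullback F w) X = pullback F (contract_form (F *m x) w) X.
Proof. by rewrite /contract /=; congr (w _); apply: (@mul_mx_row _ 4 4 1 k). Qed.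

Section Explicit.
Variables (gamma : {linear 'rV[R]_4 -> 'M[R]_4}) (hg : clifford_module gamma).
Local Notation E a := (gamma (ecov R a)).

Lemma form_action0 (w : 'M[R]_(4, 0) -> R) :
  form_action gamma w = w (basis_mx R 0 [::]) *: 1.
Proof. by rewrite form_action_basis sum_sorted0 big_nil. Qed.

Lemma form_action1 (w : 'M[R]_(4, 1) -> R) :
  form_action gamma w =
    w (basis_mx R 1 [:: i1]) *: E i1 + w (basis_mx R 1 [:: i2]) *: E i2
  + w (basis_mx R 1 [:: i3]) *: E i3 + w (basis_mx R 1 [:: i4]) *: E i4.
Proof. by rewrite form_action_basis sum_sorted1 !(big_cons, big_nil) !mulr1. Qed.

Lemma form_action2 (w : 'M[R]_(4, 2) -> R) :
  form_action gamma w =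
    w (basis_mx R 2 [:: i1; i2]) *: (E i1 * E i2)
  + w (basis_mx R 2 [:: i1; i3]) *: (E i1 * E i3)
  + w (basis_mx R 2 [:: i1; i4]) *: (E i1 * E i4)
  + w (basis_mx R 2 [:: i2; i3]) *: (E i2 * E i3)
  + w (basis_mx R 2 [:: i2; i4]) *: (E i2 * E i4)
  + w (basis_mx R 2 [:: i3; i4]) *: (E i3 * E i4).
Proof. by rewrite form_action_basis sum_sorted2 !(big_cons, big_nil) !mulr1. Qed.

Lemma form_action3 (w : 'M[R]_(4, 3) -> R) :
  form_action gamma w =
    w (basis_mx R 3 [:: i1; i2; i3]) *: (E i1 * (E i2 * E i3))
  + w (basis_mx R 3 [:: i1; i2; i4]) *: (E i1 * (E i2 * E i4))
  + w (basis_mx R 3 [:: i1; i3; i4]) *: (E i1 * (E i3 * E i4))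
  + w (basis_mx R 3 [:: i2; i3; i4]) *: (E i2 * (E i3 * E i4)).
Proof. by rewrite form_action_basis sum_sorted3 !(big_cons, big_nil) !mulr1. Qed.

Lemma form_action4 (w : 'M[R]_(4, 4) -> R) :
  form_action gamma w =
    w (basis_mx R 4 [:: i1; i2; i3; i4]) *: (E i1 * (E i2 * (E i3 * E i4))).
Proof. by rewrite form_action_basis sum_sorted4 !(big_cons, big_nil) !mulr1. Qed.

Lemma dual_metric_ecov a b :
  dual_metric (ecov R a) (ecov R b) = if a == b then if (a < 2)%N then 1 else -1 else 0.
Proof.
rewrite /dual_metric eta_inv /ecov -rowE trmx_delta -colE !mxE.
by case: eqP => [->|_]; rewrite ?mulr1n ?mulr0n.
Qed.

Lemma gamma_sq a : E a * E a = (if (a < 2)%N then 1 else -1)%:M.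
Proof. by have := hg (ecov R a); rewrite dual_metric_ecov eqxx. Qed.

Lemma gamma_anti a b : a != b -> E b * E a = - (E a * E b).
Proof.
move=> ab; have := clifford_polar hg (ecov R b) (ecov R a).
by rewrite dual_metric_ecov eq_sym (negbTE ab) mulr0 raddf0 sub0r.
Qed.

Lemma gamma_antiA a b X : a != b -> E b * (E a * X) = - (E a * (E b * X)).
Proof. by move=> ab; rewrite mulrA gamma_anti // mulNr mulrA. Qed.

End Explicit.
(** Rewriting rules that bring right-nested products in increasing order. *)
Definition gamma_sort gamma (hg : clifford_module gamma) :=
  (@gamma_antiA gamma hg i1 i2, @gamma_antiA gamma hg i1 i3,
   @gamma_antiA gamma hg i1 i4, @gamma_antiA gamma hg i2 i3,
   @gamma_antiA gamma hg i2 i4, @gamma_antiA gamma hg i3 i4,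
   @gamma_anti gamma hg i1 i2, @gamma_anti gamma hg i1 i3,
   @gamma_anti gamma hg i1 i4, @gamma_anti gamma hg i2 i3,
   @gamma_anti gamma hg i2 i4, @gamma_anti gamma hg i3 i4).

Lemma basis_swap k (w : ext_form R k) (l l' : seq 'I_4) (i j : nat) :
    (i < k)%N -> (j < k)%N -> i != j ->
    nth i1 l' i = nth i1 l j -> nth i1 l' j = nth i1 l i ->
    (forall m, m != i -> m != j -> nth i1 l' m = nth i1 l m) ->
  w (basis_mx R k l') = - w (basis_mx R k l).
Proof.
move=> ik jk ij hi hj hm.
apply: (@form_swap _ _ w _ _ (Ordinal ik) (Ordinal jk)) => [//|m|m|m n]; rewrite !mxE ?hi ?hj //.
by rewrite -!val_eqE /= => ni nj; rewrite hm.
Qed.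

Lemma basis_repeat k (w : ext_form R k) (l : seq 'I_4) (i j : nat) :
    (i < k)%N -> (j < k)%N -> i != j -> nth i1 l i = nth i1 l j ->
  w (basis_mx R k l) = 0.
Proof.
move=> ik jk ij h; apply: (@form_eqcol _ _ w _ (Ordinal ik) (Ordinal jk)) => // m.
by rewrite !mxE /= h.
Qed.

Section Swaps.
Variables (a b c d : 'I_4).
Lemma form_swap2_01 (w : ext_form R 2) :
  w (basis_mx R 2 [:: b; a]) = - w (basis_mx R 2 [:: a; b]).
Proof. by apply: (@basis_swap _ w _ _ 0 1) => // -[|[]]. Qed.
Lemma form_swap3_01 (w : ext_form R 3) :
  w (basis_mx R 3 [:: b; a; c]) = - w (basis_mx R 3 [:: a; b; c]).
Proof. by apply: (@basis_swap _ w _ _ 0 1) => // -[|[]]. Qed.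
Lemma form_swap3_12 (w : ext_form R 3) :
  w (basis_mx R 3 [:: a; c; b]) = - w (basis_mx R 3 [:: a; b; c]).
Proof. by apply: (@basis_swap _ w _ _ 1 2) => // -[|[|[]]]. Qed.
Lemma form_swap4_01 (w : ext_form R 4) :
  w (basis_mx R 4 [:: b; a; c; d]) = - w (basis_mx R 4 [:: a; b; c; d]).
Proof. by apply: (@basis_swap _ w _ _ 0 1) => // -[|[]]. Qed.
Lemma form_swap4_12 (w : ext_form R 4) :
  w (basis_mx R 4 [:: a; c; b; d]) = - w (basis_mx R 4 [:: a; b; c; d]).
Proof. by apply: (@basis_swap _ w _ _ 1 2) => // -[|[|[]]]. Qed.
Lemma form_swap4_23 (w : ext_form R 4) :
  w (basis_mx R 4 [:: a; b; d; c]) = - w (basis_mx R 4 [:: a; b; c; d]).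
Proof. by apply: (@basis_swap _ w _ _ 2 3) => // -[|[|[|[]]]]. Qed.
Lemma form_repeat2 (w : ext_form R 2) : w (basis_mx R 2 [:: a; a]) = 0.
Proof. exact: (@basis_repeat _ w _ 0 1). Qed.
Lemma form_repeat3_01 (w : ext_form R 3) : w (basis_mx R 3 [:: a; a; b]) = 0.
Proof. exact: (@basis_repeat _ w _ 0 1). Qed.
Lemma form_repeat3_02 (w : ext_form R 3) : w (basis_mx R 3 [:: a; b; a]) = 0.
Proof. exact: (@basis_repeat _ w _ 0 2). Qed.
Lemma form_repeat4_01 (w : ext_form R 4) : w (basis_mx R 4 [:: a; a; b; c]) = 0.
Proof. exact: (@basis_repeat _ w _ 0 1). Qed.
Lemma form_repeat4_02 (w : ext_form R 4) : w (basis_mx R 4 [:: a; b; a; c]) = 0.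
Proof. exact: (@basis_repeat _ w _ 0 2). Qed.
Lemma form_repeat4_03 (w : ext_form R 4) : w (basis_mx R 4 [:: a; b; c; a]) = 0.
Proof. exact: (@basis_repeat _ w _ 0 3). Qed.
End Swaps.

(** Every product over an increasing list arises [k + 1] times on the right, once
    for each choice of its first factor: moving this factor to its place changes
    the sign of the component and of the Clifford product alike, and the terms
    with a repeated index vanish.  The sum on the right pairs a basis with its
    dual basis, which makes the action of forms independent of the orthonormal
    basis; see [form_action_frame]. *)
Lemma form_action_rec gamma (hg : clifford_module gamma) k (w : ext_form R k.+1) :
  (k < 4)%N ->
  k.+1%:R *: form_action gamma w =
  \sum_a gamma (ecov R a) * form_action gamma (contract (evec R a) w).
Proof.
case: k w => [|[|[|[|//]]]] w _.
- rewrite sum4 !form_action0 form_action1 scale1r.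
  by rewrite -!scalerAr !mulr1 !contract_basis.
- rewrite sum4 !form_action1 form_action2 !contract_basis !mulrDr -!scalerAr.
  rewrite !(form_repeat2, scale0r, addr0, add0r).
  rewrite !(form_swap2_01 i1 i2, form_swap2_01 i1 i3, form_swap2_01 i1 i4).
  rewrite !(form_swap2_01 i2 i3, form_swap2_01 i2 i4, form_swap2_01 i3 i4) !gamma_sort //.
  rewrite !scalerN !scaleNr !opprK.
  apply/matrixP => i j.
  do 6 (let M := fresh "M" in set M := (_ * _ : 'M[R]_4)).
  by rewrite !mxE; ring.
- rewrite sum4 !form_action2 form_action3 !contract_basis !mulrDr -!scalerAr.
  rewrite !(form_repeat3_01, form_repeat3_02, scale0r, addr0, add0r).
  rewrite !(form_swap3_01 i1 i2, form_swap3_01 i1 i3, form_swap3_01 i1 i4).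
  rewrite !(form_swap3_01 i2 i3, form_swap3_01 i2 i4, form_swap3_01 i3 i4).
  rewrite !(form_swap3_12 _ i2 i3, form_swap3_12 _ i2 i4, form_swap3_12 _ i3 i4) !gamma_sort //.
  rewrite !(mulrN, scalerN, scaleNr, opprK).
  apply/matrixP => i j.
  do 4 (let M := fresh "M" in set M := (_ * _ : 'M[R]_4)).
  by rewrite !mxE; ring.
- rewrite sum4 !form_action3 form_action4 !contract_basis !mulrDr -!scalerAr.
  rewrite !(form_repeat4_01, form_repeat4_02, form_repeat4_03, scale0r, addr0, add0r).
  rewrite (form_swap4_01 i1 i2) (form_swap4_01 i1 i3) (form_swap4_01 i1 i4).
  rewrite !(form_swap4_12 _ i2 i3) (form_swap4_12 _ i2 i4) (form_swap4_23 _ _ i3 i4) !gamma_sort //.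
  rewrite !(mulrN, scalerN, scaleNr, opprK).
  by rewrite scalerA -!scalerDl; congr (_ *: _); ring.
Qed.

End FormAction.

(** * Null spinors *)

Section Spinors.
Variable R : realType.

Section Frame.
Variables (P : 'M[R]_3) (hP : adapted_basis P).
Variables (gamma : {linear 'rV[R]_4 -> 'M[R]_4}) (hg : clifford_module gamma).
Local Notation F := (frame P).

(** By induction on the degree, since the sum in [form_action_rec] over a basis
    and its dual basis does not depend on the basis. *)
Lemma form_action_frame k (w : ext_form R k) : (k <= 4)%N ->
  form_action gamma w = form_action (frame_gamma P gamma) (pullback F w).
Proof.
elim: k w => [|k IH] w k4.
  rewrite !form_action0 /=; congr (w _ *: _).
  by rewrite [LHS]thinmx0 [RHS]thinmx0.
have k0 : k.+1%:R != 0 :> R by rewrite pnatr_eq0.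
apply: (scalerI k0); rewrite (form_action_rec hg) // (form_action_rec (frame_clifford hP hg)) //.
under eq_bigr => b _ do rewrite (gamma_ecov_frame hP) mulr_suml.
rewrite exchange_big; apply: eq_bigr => a _ /=.
have -> : form_action (frame_gamma P gamma) (contract (evec R a) (fun X => w (F *m X))) =
    form_action (frame_gamma P gamma) (pullback F (contract_form (F *m evec R a) w)).
  by apply: eq_form_action => X; rewrite -contract_pullback.
rewrite -IH; last exact: ltnW.
rewrite /= form_action_contract mulr_sumr; apply: eq_bigr => b _.
by rewrite -scalerAr -scalerAl; congr (_ *: _); rewrite /evec -colE [RHS]mxE.
Qed.

Lemma spin_nabla_torsion_frame D (H : ext_form R 3) x xi :
  spin_nabla_torsion (frame_gamma P gamma) (ad_matrix D P) (pullback F H) x xi =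
  spin_nabla_torsion gamma D H (F *m x) xi.
Proof.
rewrite /spin_nabla_torsion -(spin_nabla_frame hP); congr (_ + _ *: (_ *m _)).
rewrite [RHS](@form_action_frame _ (contract_form (F *m x) H)) //.
by apply: eq_form_action => X; rewrite -contract_pullback.
Qed.

(** This is where the orientation of the basis enters, by [det_frame]. *)
Lemma vol_frame : pullback F (wedge_form 1%:M [tuple i1; i2; i3; i4]) =1 @vol R.
Proof.
move=> X; rewrite /vol /= /wedge !mul1mx.
have E (M : 'M[R]_4) : rowsub (tnth [tuple i1; i2; i3; i4]) M = M.
  apply/matrixP=> i j; rewrite !mxE; congr (M _ j); apply: val_inj.
  by case: i => -[|[|[|[|]]]].
by rewrite !E det_mulmx det_frame // mul1r.
Qed.

Lemma form_action_vol_frame :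
  form_action (frame_gamma P gamma) (@vol R) = form_action gamma (@vol R).
Proof.
rewrite [RHS](@form_action_frame _ (wedge_form 1%:M [tuple i1; i2; i3; i4])) //.
by apply: eq_form_action => X; rewrite vol_frame.
Qed.

End Frame.

Section Null.
Variables (gamma : {linear 'rV[R]_4 -> 'M[R]_4}) (hg : clifford_module gamma).
Local Notation E a := (gamma (ecov R a)).
Implicit Types xi v : 'cV[R]_4.

(** The spinors annihilated by the null plane of [e^2 + e^3] and [e^1 + e^4]. *)
Definition null_spinor xi := [/\ xi != 0, E i3 *m xi = - (E i2 *m xi)
                               & E i4 *m xi = - (E i1 *m xi)].

Lemma act_sq a v : E a *m (E a *m v) = (if (a < 2)%N then 1 else -1) *: v.
Proof. by rewrite mulmxA mulmxE (gamma_sq hg) mul_scalar_mx. Qed.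

Lemma act_anti a b v : a != b -> E b *m (E a *m v) = - (E a *m (E b *m v)).
Proof. by move=> ab; rewrite !mulmxA !mulmxE (gamma_anti hg ab) mulNmx. Qed.

Definition act_sort := (fun v => @act_anti i1 i2 v isT, fun v => @act_anti i1 i3 v isT,
  fun v => @act_anti i1 i4 v isT, fun v => @act_anti i2 i3 v isT,
  fun v => @act_anti i2 i4 v isT, fun v => @act_anti i3 i4 v isT).

Lemma vol_act v : form_action gamma (@vol R) *m v =
  E i1 *m (E i2 *m (E i3 *m (E i4 *m v))).
Proof.
rewrite form_action4 /vol.
have -> : wedge 1%:M [tuple i1; i2; i3; i4] (basis_mx R 4 [:: i1; i2; i3; i4]) = 1.
  by rewrite (@wedge_basis R 4 [tuple i1; i2; i3; i4] [tuple i1; i2; i3; i4]) // eqxx.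
by rewrite scale1r -!mulmxE -!mulmxA.
Qed.

Lemma null_chiral xi : null_spinor xi -> chiral gamma 1 xi.
Proof.
case=> _ h3 h4; rewrite /chiral vol_act h4 !mulmxN.
rewrite (act_anti _ (isT : i1 != i3)) mulmxN (act_anti _ (isT : i1 != i2)) !mulmxN.
by rewrite act_sq h3 /= !scale1r !mulmxN act_sq /= scale1r !opprK.
Qed.

(** The volume element is the product of [e^1 e^4] and [e^2 e^3], which both act
    on a null spinor by -1. *)
Lemma chiral_null xi : xi != 0 -> chiral gamma 1 xi ->
  E i3 *m xi = - (E i2 *m xi) -> null_spinor xi.
Proof.
move=> x0; rewrite /chiral vol_act scale1r => h h3; split=> //.
have e : E i2 *m (E i3 *m (E i4 *m xi)) = - (E i4 *m xi).
  rewrite -(opprK (E i3 *m _)) -(act_anti _ (isT : i3 != i4)).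
  by rewrite mulmxN -(act_anti _ (isT : i2 != i4)) h3 mulmxN act_sq /= scale1r mulmxN.
by move: h; rewrite e => h; rewrite -{2}h !mulmxN act_sq /= scale1r opprK.
Qed.

(** [e^2 + e^3] and [e^1 + e^4] act by operators [N] and [M] that square to zero
    and anticommute: apply [N] to a non-zero spinor, unless it is already killed,
    and then [M] in the same way. *)
Lemma null_exists : exists xi, null_spinor xi.
Proof.
pose N v := E i2 *m v + E i3 *m v; pose M v := E i1 *m v + E i4 *m v.
have N2 v : N (N v) = 0.
  rewrite /N !mulmxDr !act_sq act_sort /= scale1r scaleN1r.
  by rewrite addrA addrK subrr.
have M2 v : M (M v) = 0.
  rewrite /M !mulmxDr !act_sq act_sort /= scale1r scaleN1r.
  by rewrite addrA addrK subrr.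
have NM v : N (M v) = - M (N v).
  rewrite /N /M !mulmxDr !(act_anti _ (isT : i1 != i2), act_anti _ (isT : i1 != i3)).
  by rewrite (act_anti _ (isT : i2 != i4)) (act_anti _ (isT : i3 != i4)) !opprD !opprK addrACA.
have M0 : M 0 = 0 by rewrite /M !mulmx0 addr0.
pose v : 'cV[R]_4 := delta_mx 0 0.
have v0 : v != 0 by apply/eqP=> /matrixP /(_ 0 0) /eqP; rewrite !mxE eqxx oner_eq0.
have [u u0 Nu] : exists2 u, u != 0 & N u = 0.
  by case: (eqVneq (N v) 0) => [|Nv]; [exists v | exists (N v)].
have [t [t0 Nt Mt]] : exists t, [/\ t != 0, N t = 0 & M t = 0].
  case: (eqVneq (M u) 0) => [|Mu]; first by exists u.
  by exists (M u); rewrite NM Nu M0 oppr0.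
by exists t; split=> //; apply/eqP; rewrite -addr_eq0 addrC; apply/eqP.
Qed.

(** [e^1 e^2] squares to -1, hence it acts on spinors as a complex structure. *)
Lemma indep_e12 (a b : R) xi : xi != 0 ->
  a *: xi + b *: (E i1 *m (E i2 *m xi)) = 0 -> a = 0 /\ b = 0.
Proof.
move=> x0 h.
have : (a ^+ 2 + b ^+ 2) *: xi = 0.
  have := congr1 (fun v => a *: v - b *: (E i1 *m (E i2 *m v))) h => /=.
  rewrite !mulmx0 !scaler0 subr0 !mulmxDr -!scalemxAr => <-.
  rewrite (act_anti _ (isT : i1 != i2)) mulmxN !act_sq /= !scale1r.
  by rewrite !scalerDr !scalerN !scalerA scalerDl !expr2; apply/matrixP=> i j; rewrite !mxE; ring.
move/eqP; rewrite scaler_eq0 (negbTE x0) orbF paddr_eq0 ?sqr_ge0 // !sqrf_eq0.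
by case/andP=> /eqP -> /eqP ->.
Qed.

Lemma vol_anti a v :
  form_action gamma (@vol R) *m (E a *m v) = - (E a *m (form_action gamma (@vol R) *m v)).
Proof.
by case: (ord4_cases a) => ->; rewrite !vol_act ?(act_sort, mulmxN, opprK).
Qed.

(** The four spinors [xi], [e^1 e^2 xi], [e^1 xi], [e^2 xi] form a basis of the
    spinor space, the first two having the chirality of [xi] and the last two the
    opposite one. *)
Lemma chiral_span xi v : xi != 0 -> chiral gamma 1 xi -> chiral gamma (-1) v ->
  exists a b, v = a *: (E i1 *m xi) + b *: (E i2 *m xi).
Proof.
rewrite /chiral scale1r scaleN1r; set nu := form_action gamma _ => x0 hx hv.
have nuN a : nu *m (E a *m xi) = - (E a *m xi) by rewrite vol_anti hx.
have nuP : nu *m (E i1 *m (E i2 *m xi)) = E i1 *m (E i2 *m xi).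
  by rewrite vol_anti nuN mulmxN opprK.
pose B : 'M[R]_4 := \matrix_(i < 4) (nth 0
  [:: xi; E i1 *m (E i2 *m xi); E i1 *m xi; E i2 *m xi] i)^T.
have BE (u : 'rV[R]_4) : (u *m B)^T = u 0 i1 *: xi + u 0 i2 *: (E i1 *m (E i2 *m xi))
    + u 0 i3 *: (E i1 *m xi) + u 0 i4 *: (E i2 *m xi).
  by rewrite mulmx_sum_row sum4 !rowK /= !linearD !linearZ /= !trmxK.
have split4 a b c d w :
    w = a *: xi + b *: (E i1 *m (E i2 *m xi))
      + c *: (E i1 *m xi) + d *: (E i2 *m xi) ->
    nu *m w = a *: xi + b *: (E i1 *m (E i2 *m xi))
      - c *: (E i1 *m xi) - d *: (E i2 *m xi).
  by move=> ->; rewrite !mulmxDr -!scalemxAr hx nuP !nuN !scalerN.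
have uB : B \in unitmx.
  rewrite -row_free_unit; apply: inj_row_free => u hu.
  have h := BE u; rewrite hu trmx0 in h.
  have h' := split4 _ _ _ _ _ h; rewrite mulmx0 in h'.
  have [u1 u2] : u 0 i1 = 0 /\ u 0 i2 = 0.
    apply: (indep_e12 x0); apply/matrixP=> i j.
    move/matrixP: h => /(_ i j); move/matrixP: h' => /(_ i j).
    set z := E i1 *m _; set z1 := E i1 *m _; set z2 := E i2 *m _.
    by rewrite !mxE; lra.
  rewrite u1 u2 !scale0r !add0r in h.
  have [u3 u4] : u 0 i3 = 0 /\ u 0 i4 = 0.
    apply: (indep_e12 x0).
    have := congr1 (mulmx (E i1)) h.
    by rewrite mulmx0 mulmxDr -!scalemxAr act_sq /= scale1r => <-.
  apply/rowP=> i; rewrite mxE.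
  by case: (ord4_cases i) => ->.
have hB := BE (v^T *m invmx B); rewrite mulmxKV // trmxK in hB.
set u := v^T *m invmx B in hB.
exists (u 0 i3), (u 0 i4).
have := split4 _ _ _ _ _ hB; rewrite hv => h'.
apply/matrixP=> i j.
move/matrixP: hB => /(_ i j); move/matrixP: h' => /(_ i j).
set z := E i1 *m _; set z1 := E i1 *m _; set z2 := E i2 *m _.
by rewrite !mxE; lra.
Qed.

End Null.
End Spinors.

(** * Frames adapted to a chiral spinor *)

Section Coordinates.
Variable R : realType.

Definition o1 : 'I_3 := @Ordinal 3 0 isT.
Definition o2 : 'I_3 := @Ordinal 3 1 isT.
Definition o3 : 'I_3 := @Ordinal 3 2 isT.

Lemma sum3 (V : nmodType) (G : 'I_3 -> V) : \sum_(i < 3) G i = G o1 + G o2 + G o3.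
Proof.
rewrite !big_ord_recl big_ord0 addr0 !addrA.
by congr (G _ + G _ + G _); apply: val_inj.
Qed.

Lemma det3 (A : 'M[R]_3) : \det A =
  A o1 o1 * (A o2 o2 * A o3 o3 - A o2 o3 * A o3 o2)
  - A o1 o2 * (A o2 o1 * A o3 o3 - A o2 o3 * A o3 o1)
  + A o1 o3 * (A o2 o1 * A o3 o2 - A o2 o2 * A o3 o1).
Proof.
pose f (i j : nat) := A (inord i) (inord j).
have AE i j : A i j = f i j by rewrite /f !inord_val.
rewrite (expand_det_row _ ord0) !big_ord_recl big_ord0 /cofactor.
rewrite !(expand_det_row _ ord0) !big_ord_recl !big_ord0 /cofactor !det_mx11 !mxE !AE /=.
by rewrite /bump /=; ring.
Qed.

Lemma i1E : i1 = lshift 1 o1. Proof. exact: val_inj. Qed.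
Lemma i2E : i2 = lshift 1 o2. Proof. exact: val_inj. Qed.
Lemma i3E : i3 = lshift 1 o3. Proof. exact: val_inj. Qed.
Lemma i4E : i4 = rshift 3 (0 : 'I_1). Proof. exact: val_inj. Qed.

Lemma frame_lr (P : 'M[R]_3) (i j : 'I_3) : frame P (lshift 1 i) (lshift 1 j) = P i j.
Proof. exact: block_mxEul. Qed.
Lemma frame_l4 (P : 'M[R]_3) (i : 'I_3) : frame P (lshift 1 i) i4 = 0.
Proof. by rewrite i4E [LHS]block_mxEur mxE. Qed.
Lemma frame_4r (P : 'M[R]_3) (j : 'I_3) : frame P i4 (lshift 1 j) = 0.
Proof. by rewrite i4E [LHS]block_mxEdl mxE. Qed.
Lemma frame_44 (P : 'M[R]_3) : frame P i4 i4 = 1.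
Proof. by rewrite i4E [LHS]block_mxEdr mxE. Qed.
Definition frameE := (i1E, i2E, i3E, frame_lr, frame_l4, frame_4r, frame_44).

Lemma metricE (x y : 'cV[R]_4) : metric x y =
  x i1 0 * y i1 0 + x i2 0 * y i2 0 - x i3 0 * y i3 0 - x i4 0 * y i4 0.
Proof.
rewrite /metric -mulmxA mxE sum4 /eta mul_diag_mx !mxE /=.
by ring.
Qed.

Lemma frame_adapted (P : 'M[R]_3) : 0 < \det P ->
  (forall i j, metric (col i (frame P)) (col j (frame P)) = eta R i j) ->
  adapted_basis P.
Proof.
move=> hP h; split=> //; apply/matrixP=> i j; rewrite -h /metric.
by rewrite tr_col [col j _]colE mulmxA -!row_mul -colE [RHS]mxE [RHS]mxE.
Qed.

Section Rotation.
Variables (gamma : {linear 'rV[R]_4 -> 'M[R]_4}) (hg : clifford_module gamma).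
Local Notation E a := (gamma (ecov R a)).

(** [e^3 xi] has chirality -1, hence it is [a e^1 xi + b e^2 xi], and
    [e^3 e^3 = -1] gives [a^2 + b^2 = 1].  The rotation is chosen so that the
    second covector of the new dual basis is [- (a e^1 + b e^2)]. *)
Lemma chiral_frame (xi : 'cV[R]_4) : xi != 0 -> chiral gamma 1 xi ->
  exists P, adapted_basis P /\ null_spinor (frame_gamma P gamma) xi.
Proof.
move=> x0 hx.
have h3 : chiral gamma (-1) (E i3 *m xi).
  by move: hx; rewrite /chiral scale1r scaleN1r vol_anti // => ->.
have [a [b hab]] := chiral_span hg x0 hx h3.
have ab1 : a * a + b * b = 1.
  have := congr1 (mulmx (E i3)) hab; rewrite act_sq //= scaleN1r.
  rewrite mulmxDr -!scalemxAr (act_anti hg _ (isT : i1 != i3)).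
  rewrite (act_anti hg _ (isT : i2 != i3)) hab !mulmxDr -!scalemxAr !act_sq //= !scale1r.
  rewrite (act_anti hg _ (isT : i1 != i2)) => h.
  have : (a * a + b * b - 1) *: xi = 0.
    move: h; set z := E i1 *m _ => h; apply/matrixP=> i j.
    by move/matrixP: h => /(_ i j); rewrite !mxE; lra.
  by move/eqP; rewrite scaler_eq0 (negbTE x0) orbF subr_eq0 => /eqP.
pose P : 'M[R]_3 := mx3 [:: [:: - b; - a; 0]; [:: a; - b; 0]; [:: 0; 0; 1]].
have PE i j : P i j = nth 0 (nth [::] [:: [:: - b; - a; 0]; [:: a; - b; 0]; [:: 0; 0; 1]] i) j.
  by rewrite mxE.
have hP : adapted_basis P.
  apply: frame_adapted => [|i j].
    by rewrite det3 !PE /=; nra.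
  have -> : eta R i j = (if (j < 2)%N then 1 else -1) *+ (i == j).
    by rewrite /eta !mxE; case: eqP => [->|].
  rewrite metricE ![col _ _ _ _]mxE.
  by case: (ord4_cases i) => ->; case: (ord4_cases j) => ->;
     rewrite !frameE ?PE /= ?mulr1n ?mulr0n; lra.
exists P; split=> //; apply: (chiral_null (frame_clifford hP hg) x0).
  by rewrite /chiral form_action_vol_frame.
move: hab; rewrite !(gamma_ecov_frame hP gamma) !sum4 !frameE !PE /=.
rewrite !(scale0r, scale1r, add0r, addr0) => ->.
rewrite !mulmxDl -!scalemxAl.
move: (_ *m xi) (_ *m xi) => u v; apply/matrixP=> i j; rewrite !mxE.
rewrite -[in RHS](mulr1 (u i j)) -ab1.
by ring.
Qed.

End Rotation.
End Coordinates.

(** * Closed forms *)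

Section Equations.
Variable R : realType.
Implicit Types (D : 'M[R]_3) (x y z : 'cV[R]_4).

Lemma lieE D x y (i : 'I_3) : lie D x y (lshift 1 i) 0 =
  \sum_j D i j * (x i4 0 * y (lshift 1 j) 0 - y i4 0 * x (lshift 1 j) 0).
Proof.
rewrite /lie (@col_mxEu _ 3 1) !mxE -i4E !mulr_sumr -sumrB.
by apply: eq_bigr => j _; rewrite !mxE; ring.
Qed.

Lemma lie_e4 D x y : lie D x y i4 0 = 0.
Proof. by rewrite i4E /lie (@col_mxEd _ 3 1) mxE. Qed.

Lemma lie_entries D x y :
  let br j := x i4 0 * y j 0 - y i4 0 * x j 0 in
  (lie D x y i1 0 = D o1 o1 * br i1 + D o1 o2 * br i2 + D o1 o3 * br i3) *
  (lie D x y i2 0 = D o2 o1 * br i1 + D o2 o2 * br i2 + D o2 o3 * br i3) *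
  (lie D x y i3 0 = D o3 o1 * br i1 + D o3 o2 * br i2 + D o3 o3 * br i3).
Proof. by rewrite /= !(i1E, i2E, i3E) !lieE !sum3. Qed.

Lemma form1_eval (w : ext_form R 1) (X : 'M[R]_(4, 1)) : w X =
  w (basis_mx R 1 [:: i1]) * X i1 0 + w (basis_mx R 1 [:: i2]) * X i2 0
  + w (basis_mx R 1 [:: i3]) * X i3 0 + w (basis_mx R 1 [:: i4]) * X i4 0.
Proof.
rewrite [LHS]form1_expand /wedge mul1mx !det_mx11 !mxE.
by rewrite !(tnth_nth i1).
Qed.

Definition minor3 (X : 'M[R]_(4, 3)) (a b c : 'I_4) : R :=
  X a o1 * (X b o2 * X c o3 - X b o3 * X c o2)
  - X a o2 * (X b o1 * X c o3 - X b o3 * X c o1)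
  + X a o3 * (X b o1 * X c o2 - X b o2 * X c o1).

Lemma form3_eval (w : ext_form R 3) (X : 'M[R]_(4, 3)) : w X =
  w (basis_mx R 3 [:: i1; i2; i3]) * minor3 X i1 i2 i3
  + w (basis_mx R 3 [:: i1; i2; i4]) * minor3 X i1 i2 i4
  + w (basis_mx R 3 [:: i1; i3; i4]) * minor3 X i1 i3 i4
  + w (basis_mx R 3 [:: i2; i3; i4]) * minor3 X i2 i3 i4.
Proof.
rewrite [LHS]form3_expand /wedge mul1mx !det3 !mxE.
by rewrite !(tnth_nth i1).
Qed.

Lemma ce_d1 D (w : ext_form R 1) (X : 'M[R]_(4, 2)) :
  ce_d D (k := 0) w X = - w (lie D (col 0 X) (col 1 X)).
Proof.
rewrite /ce_d big_ord_recl big_ord1.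
rewrite big_pred0 ?add0r; last by case.
rewrite big_mkcond big_ord1 /= expr1 mulN1r; congr (- w _).
apply/matrixP=> i j; rewrite row_mx1E (ord1 j).
case: unliftP => [[] //|_]; congr (lie D _ _ i 0).
- by apply/matrixP=> k l; rewrite !mxE; congr (X k _); apply: val_inj.
- by apply/matrixP=> k l; rewrite !mxE; congr (X k _); apply: val_inj.
Qed.

Lemma ce_closed1 D (w : ext_form R 1) :
  ce_closed D (k := 0) w <-> forall j, w (basis_mx R 1 [:: i1]) * D o1 j
    + w (basis_mx R 1 [:: i2]) * D o2 j + w (basis_mx R 1 [:: i3]) * D o3 j = 0.
Proof.
split=> [h j|h X].
  have /eqP := h (row_mx (evec R i4) (evec R (lshift 1 j))); rewrite ce_d1.
  rewrite oppr_eq0 form1_eval lie_e4 mulr0 addr0 => /eqP.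
  have -> : col 0 (row_mx (evec R i4) (evec R (lshift 1 j))) = evec R i4.
    by apply/matrixP=> a b; rewrite mxE row_mx1E ord1; case: unliftP => [[]|].
  have -> : col 1 (row_mx (evec R i4) (evec R (lshift 1 j))) = evec R (lshift 1 j).
    apply/matrixP=> a b; rewrite mxE row_mx1E (ord1 b).
    by case: unliftP => [c _|//]; rewrite (ord1 c).
  have E (a : 'I_3) : lie D (evec R i4) (evec R (lshift 1 j)) (lshift 1 a) 0 = D a j.
    have n (k : 'I_3) : (i4 == lshift 1 k) = false.
      by rewrite -val_eqE /= gtn_eqF.
    have m (k l : 'I_3) : (lshift 1 k == lshift 1 l :> 'I_4) = (k == l) by [].
    rewrite lieE (bigD1 j) //= big1 ?addr0 => [|k kj].
      by rewrite !mxE !eqxx n /= mul0r subr0 !mulr1.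
    by rewrite !mxE m (negbTE kj) n /= !(mulr0, mul0r) subr0 mulr0.
  by rewrite !(i1E, i2E, i3E) !E.
rewrite ce_d1 form1_eval lie_e4 mulr0 addr0 !lie_entries.
set p := w _ in h *; set q := w _ in h *; set r := w _ in h *.
have := h o1; have := h o2; have := h o3.
set x := col 0 X; set y := col 1 X.
set b1 := x i4 0 * y i1 0 - _; set b2 := x i4 0 * y i2 0 - _.
set b3 := x i4 0 * y i3 0 - _ => h1 h2 h3.
apply/eqP; rewrite oppr_eq0; apply/eqP.
transitivity ((p * D o1 o1 + q * D o2 o1 + r * D o3 o1) * b1
  + (p * D o1 o2 + q * D o2 o2 + r * D o3 o2) * b2
  + (p * D o1 o3 + q * D o2 o3 + r * D o3 o3) * b3); first by ring.
by rewrite h1 h2 h3 !mul0r !addr0.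
Qed.

Lemma sum3_cond (V : nmodType) (P : pred 'I_3) (G : 'I_3 -> V) :
  \sum_(i < 3 | P i) G i =
    (if P o1 then G o1 else 0) + (if P o2 then G o2 else 0)
    + (if P o3 then G o3 else 0).
Proof. by rewrite big_mkcond sum3. Qed.

Lemma minor3_row (x y z : 'cV[R]_4) a b c :
  minor3 (row_mx x (row_mx y z)) a b c =
    x a 0 * (y b 0 * z c 0 - z b 0 * y c 0)
    - y a 0 * (x b 0 * z c 0 - z b 0 * x c 0)
    + z a 0 * (x b 0 * y c 0 - y b 0 * x c 0).
Proof.
have E k : [/\ row_mx x (row_mx y z) k o1 = x k 0,
   row_mx x (row_mx y z) k o2 = y k 0 & row_mx x (row_mx y z) k o3 = z k 0].
  have -> : o1 = lshift 2 (0 : 'I_1) by apply: val_inj.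
  have -> : o2 = rshift 1 (lshift 1 (0 : 'I_1)) by apply: val_inj.
  have -> : o3 = rshift 1 (rshift 1 (0 : 'I_1)) by apply: val_inj.
  by split; [exact: row_mxEl | apply: etrans (row_mxEr _ _ _ _) _; exact: row_mxEl
    | apply: etrans (row_mxEr _ _ _ _) _; exact: row_mxEr].
rewrite /minor3; case: (E a) => -> -> ->; case: (E b) => -> -> ->.
by case: (E c) => -> -> ->.
Qed.

Lemma ce_d3 D (w : ext_form R 3) (X : 'M[R]_4) :
  let T i j k l := w (row_mx (lie D (col i X) (col j X)) (row_mx (col k X) (col l X))) in
  ce_d D (k := 2) w X =
    - T i1 i2 i3 i4 + T i1 i3 i2 i4 - T i2 i3 i1 i4
    - T i1 i4 i2 i3 + T i2 i4 i1 i3 - T i3 i4 i1 i2.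
Proof.
move=> T.
have E (j : 'I_4) (i : 'I_3) (p q k l : 'I_4) :
    val j = val q -> bump j i = p -> bump j (bump i 0) = k -> bump j (bump i 1) = l ->
    w (row_mx (lie D (col i (col' j X)) (col j X)) (col' i (col' j X))) = T p q k l.
  move=> jq ip ik il; congr (w (row_mx (lie D _ _) _)).
  - by apply/matrixP=> a b; rewrite !mxE; congr (X a _); apply: val_inj.
  - by congr (col _ X); apply: val_inj.
  - apply/matrixP=> a m; rewrite row_mx1E !mxE.
    case: unliftP => [c ->|->]; rewrite ?(ord1 c) ?mxE; congr (X a _); exact: val_inj.
rewrite /ce_d sum4 !sum3_cond /= !(add0r, addr0).
rewrite (E i2 o1 i1 i2 i3 i4) // (E i3 o1 i1 i3 i2 i4) // (E i3 o2 i2 i3 i1 i4) //.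
rewrite (E i4 o1 i1 i4 i2 i3) // (E i4 o2 i2 i4 i1 i3) // (E i4 o3 i3 i4 i1 i2) //.
by rewrite !exprS !expr0; ring.
Qed.

(** The coefficient of the component [w_abc] in [ce_d D w X]. *)
Definition ce_minor D (X : 'M[R]_4) a b c :=
  let m i j k l := minor3
    (row_mx (lie D (col i X) (col j X)) (row_mx (col k X) (col l X))) a b c in
  - m i1 i2 i3 i4 + m i1 i3 i2 i4 - m i2 i3 i1 i4
  - m i1 i4 i2 i3 + m i2 i4 i1 i3 - m i3 i4 i1 i2.

Lemma minor3_lie D x y z t :
  let br j := x i4 0 * y j 0 - y i4 0 * x j 0 in
  let d i := D i o1 * br i1 + D i o2 * br i2 + D i o3 * br i3 in
  let M := minor3 (row_mx (lie D x y) (row_mx z t)) in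
  let zt a b := z a 0 * t b 0 - t a 0 * z b 0 in
  (M i1 i2 i3 = d o1 * zt i2 i3 - d o2 * zt i1 i3 + d o3 * zt i1 i2) *
  (M i1 i2 i4 = d o1 * zt i2 i4 - d o2 * zt i1 i4) *
  (M i1 i3 i4 = d o1 * zt i3 i4 - d o3 * zt i1 i4) *
  (M i2 i3 i4 = d o2 * zt i3 i4 - d o3 * zt i2 i4).
Proof. by rewrite /= !minor3_row lie_e4 !lie_entries /=; split; [split; [split|]|]; ring. Qed.

(** Each [d e^i] is a multiple of [e^4] by a 1-form, and [d e^4 = 0], so that
    [e^4] would occur twice in the differential of [e^ab4]. *)
Lemma ce_minor_e4 D (X : 'M[R]_4) :
  [/\ ce_minor D X i1 i2 i4 = 0, ce_minor D X i1 i3 i4 = 0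
    & ce_minor D X i2 i3 i4 = 0].
Proof.
have xE a k : col k X a 0 = X a k by rewrite mxE.
by rewrite /ce_minor !minor3_lie !xE; split; ring.
Qed.

(** [ce_minor D X i1 i2 i3] is [\tr D * \det X]; that it vanishes with [\tr D]
    and its value at the identity matrix suffice for [ce_closed3]. *)
Lemma ce_minor_tr D (X : 'M[R]_4) : \tr D = 0 -> ce_minor D X i1 i2 i3 = 0.
Proof.
rewrite /mxtrace sum3 => /eqP; rewrite addrC addr_eq0 => /eqP tD.
have xE a k : col k X a 0 = X a k by rewrite mxE.
by rewrite /ce_minor !minor3_lie !xE tD; ring.
Qed.

Lemma ce_minor1 D : ce_minor D 1%:M i1 i2 i3 = \tr D.
Proof.
have xE a k : col k 1%:M a 0 = (a == k)%:R :> R by rewrite !mxE.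
by rewrite /ce_minor !minor3_lie !xE /mxtrace sum3 /=; ring.
Qed.

Lemma ce_d3_minor D (w : ext_form R 3) (X : 'M[R]_4) :
  ce_d D (k := 2) w X = w (basis_mx R 3 [:: i1; i2; i3]) * ce_minor D X i1 i2 i3.
Proof.
have [e1 e2 e3] := ce_minor_e4 D X.
transitivity (w (basis_mx R 3 [:: i1; i2; i3]) * ce_minor D X i1 i2 i3
  + w (basis_mx R 3 [:: i1; i2; i4]) * ce_minor D X i1 i2 i4
  + w (basis_mx R 3 [:: i1; i3; i4]) * ce_minor D X i1 i3 i4
  + w (basis_mx R 3 [:: i2; i3; i4]) * ce_minor D X i2 i3 i4).
  have T (x y z : 'cV[R]_4) := form3_eval w (row_mx x (row_mx y z)).
  by rewrite ce_d3 !T /ce_minor; ring.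
by rewrite e1 e2 e3 !mulr0 !addr0.
Qed.

(** [d e^123] is [\tr D] times a volume form, while [d e^ab4 = 0]. *)
Lemma ce_closed3 D (w : ext_form R 3) :
  ce_closed D (k := 2) w <-> w (basis_mx R 3 [:: i1; i2; i3]) * \tr D = 0.
Proof.
split=> [h|/eqP h X].
  by have := h 1%:M; rewrite ce_d3_minor ce_minor1.
rewrite ce_d3_minor; move: h; rewrite mulf_eq0 => /orP[/eqP ->|/eqP tD].
  by rewrite mul0r.
by rewrite ce_minor_tr // mulr0.
Qed.

End Equations.

(** * Parallel null spinors *)

Section Torsion.
Variable R : realType.

Lemma koszul_anti (D : 'M[R]_3) x y z : koszul D x y z = - koszul D x z y.
Proof.
rewrite /koszul (lieN D y z) (lieN D x y) (lieN D x z) !metricNl.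
by rewrite (metricC _ z) (metricC _ y); ring.
Qed.

Lemma koszul_diag (D : 'M[R]_3) x y : koszul D x y y = 0.
Proof. by have := koszul_anti D x y y; lra. Qed.

Lemma col_basis2 (a b : 'I_4) :
  (col 0 (basis_mx R 2 [:: a; b]) = evec R a) *
  (col 1 (basis_mx R 2 [:: a; b]) = evec R b).
Proof. by split; apply/matrixP=> i j; rewrite !mxE (ord1 j) eqxx andbT. Qed.

Variables (gamma : {linear 'rV[R]_4 -> 'M[R]_4}) (hg : clifford_module gamma).
Variables (xi : 'cV[R]_4) (hxi : null_spinor gamma xi).
Local Notation E a := (gamma (ecov R a)).
Local Notation e12 := (E i1 *m (E i2 *m xi)).

(** Purity: the products of two covectors map [xi] to multiples of [xi] and of
    [e^1 e^2 xi]. *)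
Lemma null_act2 :
  (E i1 *m (E i3 *m xi) = - e12) * (E i1 *m (E i4 *m xi) = - xi)
  * (E i2 *m (E i3 *m xi) = - xi) * (E i2 *m (E i4 *m xi) = e12)
  * (E i3 *m (E i4 *m xi) = - e12).
Proof.
case: hxi => _ h3 h4.
rewrite h4 h3 !mulmxN (act_anti hg _ (isT : i1 != i2)) (act_anti hg _ (isT : i1 != i3)).
by rewrite h3 !act_sq //= scale1r mulmxN !opprK.
Qed.

Lemma form_action2_null (w : 'M[R]_(4, 2) -> R) :
  form_action gamma w *m xi =
    (w (basis_mx R 2 [:: i1; i2]) - w (basis_mx R 2 [:: i1; i3])
     + w (basis_mx R 2 [:: i2; i4]) - w (basis_mx R 2 [:: i3; i4])) *: e12
    - (w (basis_mx R 2 [:: i1; i4]) + w (basis_mx R 2 [:: i2; i3])) *: xi.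
Proof.
rewrite form_action2 !mulmxDl -!scalemxAl -!mulmxE -!mulmxA !null_act2.
move: e12 => u; apply/matrixP=> i j.
by rewrite !mxE; ring.
Qed.

Lemma form_action3_null (w : 'M[R]_(4, 3) -> R) :
  form_action gamma w *m xi =
    (w (basis_mx R 3 [:: i2; i3; i4]) - w (basis_mx R 3 [:: i1; i2; i3]))
      *: (E i1 *m xi)
    + (w (basis_mx R 3 [:: i1; i2; i4]) - w (basis_mx R 3 [:: i1; i3; i4]))
      *: (E i2 *m xi).
Proof.
rewrite form_action3 !mulmxDl -!scalemxAl -!mulmxE -!mulmxA !null_act2 !mulmxN.
rewrite (act_anti hg _ (isT : i1 != i2)) !act_sq //= !scale1r.
move: (E i1 *m xi) (E i2 *m xi) => u v; apply/matrixP=> i j.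
by rewrite !mxE; ring.
Qed.

Lemma form_action1_null (w : 'M[R]_(4, 1) -> R) :
  form_action gamma w *m xi =
    (w (basis_mx R 1 [:: i1]) - w (basis_mx R 1 [:: i4])) *: (E i1 *m xi)
    + (w (basis_mx R 1 [:: i2]) - w (basis_mx R 1 [:: i3])) *: (E i2 *m xi).
Proof.
case: hxi => _ h3 h4.
rewrite form_action1 !mulmxDl -!scalemxAl h3 h4.
move: (E i1 *m xi) (E i2 *m xi) => u v; apply/matrixP=> i j.
by rewrite !mxE; ring.
Qed.

(** The connection matrix is skew, so that the double sum over [a] and [b] folds
    into twice the sum over [a < b]. *)
Lemma spin_nabla_koszul D x : spin_nabla gamma D x =
  4^-1 *: form_action gamma (fun X : 'M[R]_(4, 2) => koszul D x (col 1 X) (col 0 X)).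
Proof.
have fE b : gamma (flat (nabla D x (evec R b))) =
    \sum_a (2^-1 * koszul D x (evec R b) (evec R a)) *: E a.
  rewrite /nabla flat_sharp (row_sum_delta (\row__ _)) linear_sum.
  by apply: eq_bigr => a _; rewrite linearZ mxE.
rewrite /spin_nabla; congr (_ *: _).
under eq_bigr => b _ do rewrite fE mulmx_suml.
rewrite form_action2 !sum4 -!scalemxAl !col_basis2 !koszul_diag !mulr0 !scale0r.
rewrite !(koszul_anti D x (evec R i1)) (koszul_anti D x (evec R i2) (evec R i3)).
rewrite (koszul_anti D x (evec R i2) (evec R i4)) (koszul_anti D x (evec R i3) (evec R i4)).
rewrite !mulmxE !(gamma_sort hg) //.
apply/matrixP=> i j.
do 6 (let M := fresh "M" in move: (E _ * E _ : 'M[R]_4) => M).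
move: (koszul D x) (evec R) => K e.
by rewrite !mxE; field.
Qed.

(** Twice the coefficient [g (nabla_x e_b, e_a)] of the metric connection
    with torsion that lifts to [spin_nabla_torsion] on spinors. *)
Definition torsion2 D (H : ext_form R 3) x a b : R :=
  koszul D x (evec R b) (evec R a) + contract x H (basis_mx R 2 [:: a; b]).

Lemma torsion_null D (H : ext_form R 3) x :
  let t := torsion2 D H x in
  spin_nabla_torsion gamma D H x xi = 0 <->
  t i1 i2 - t i1 i3 + t i2 i4 - t i3 i4 = 0 /\ t i1 i4 + t i2 i3 = 0.
Proof.
move=> t; have [x0 _ _] := hxi.
have -> : spin_nabla_torsion gamma D H x xi = 4^-1 *:
    (- (t i1 i4 + t i2 i3) *: xi
     + (t i1 i2 - t i1 i3 + t i2 i4 - t i3 i4) *: e12).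
  rewrite /spin_nabla_torsion spin_nabla_koszul -scalemxAl !form_action2_null.
  rewrite /t /torsion2 !col_basis2.
  move: e12 (koszul D x) (evec R) (contract x H) => u K e C.
  by apply/matrixP=> i j; rewrite !mxE; ring.
split=> [/eqP|[-> ->]]; last by rewrite oppr0 !scale0r addr0 scaler0.
rewrite scaler_eq0 invr_eq0 pnatr_eq0 /= => /eqP /(indep_e12 hg x0) [h1 h2].
by split=> //; apply/eqP; rewrite -oppr_eq0 h1.
Qed.

End Torsion.

(** * The structure equations *)

Section System.

Lemma ord3_cases (a : 'I_3) : [\/ a = o1, a = o2 | a = o3].
Proof.
by case: a => -[|[|[|//]]] p; [apply: Or31|apply: Or32|apply: Or33];
  apply: val_inj.
Qed.

Variable R : realType.
Implicit Types (D : 'M[R]_3) (H : ext_form R 3).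

Lemma koszulE D x y z : koszul D x y z =
  let br u v j := u i4 0 * v j 0 - v i4 0 * u j 0 in
  let m u v w :=
    (D o1 o1 * br u v i1 + D o1 o2 * br u v i2 + D o1 o3 * br u v i3) * w i1 0
    + (D o2 o1 * br u v i1 + D o2 o2 * br u v i2 + D o2 o3 * br u v i3) * w i2 0
    - (D o3 o1 * br u v i1 + D o3 o2 * br u v i2 + D o3 o3 * br u v i3) * w i3 0 in
  m x y z - m y z x + m z x y.
Proof.
have E u v w : metric (lie D u v) w =
    lie D u v i1 0 * w i1 0 + lie D u v i2 0 * w i2 0 - lie D u v i3 0 * w i3 0.
  by rewrite metricE lie_e4 mul0r subr0.
by rewrite /koszul !E !(lie_entries D x y, lie_entries D y z, lie_entries D z x) /=.
Qed.

Local Notation h H l := (form_val H (basis_mx R 3 l)).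

Lemma contractE H x a b : contract x H (basis_mx R 2 [:: a; b]) =
  x i1 0 * h H [:: i1; a; b] + x i2 0 * h H [:: i2; a; b]
  + x i3 0 * h H [:: i3; a; b] + x i4 0 * h H [:: i4; a; b].
Proof. by rewrite contract_sum sum4 !contract_basis. Qed.

(** Both expressions are linear in [x]; the right-hand side lists their
    coefficients, first those of [t_14 + t_23]. *)
Lemma torsion_system D H :
  (forall x, let t := torsion2 D H x in
     t i1 i2 - t i1 i3 + t i2 i4 - t i3 i4 = 0 /\ t i1 i4 + t i2 i3 = 0) <->
  [/\ [/\ h H [:: i1; i2; i3] = 2 * D o1 o1,
          h H [:: i1; i2; i4] = - (D o1 o2 + D o2 o1),
          h H [:: i1; i3; i4] = D o3 o1 - D o1 o3 &
          h H [:: i2; i3; i4] = - (D o2 o3 + D o3 o2)],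
      - D o1 o2 + D o1 o3 - D o2 o1 - D o3 o1
        + h H [:: i1; i2; i4] - h H [:: i1; i3; i4] = 0,
      D o1 o2 - D o1 o3 - D o2 o1 - D o3 o1
        + h H [:: i1; i2; i4] - h H [:: i1; i3; i4] = 0,
      - (2 * D o2 o2) + D o2 o3 - D o3 o2
        + h H [:: i1; i2; i3] - h H [:: i2; i3; i4] = 0 &
      - D o2 o3 + D o3 o2 - 2 * D o3 o3
        + h H [:: i1; i2; i3] - h H [:: i2; i3; i4] = 0].
Proof.
have eE (a b : 'I_4) : evec R a b 0 = (b == a)%:R by rewrite !mxE andbT.
have E x : let t := torsion2 D H x in
   (t i1 i2 - t i1 i3 + t i2 i4 - t i3 i4 =
   x i1 0 * (- D o1 o2 + D o1 o3 - D o2 o1 - D o3 o1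
        + h H [:: i1; i2; i4] - h H [:: i1; i3; i4]) +
   x i2 0 * (- (2 * D o2 o2) + D o2 o3 - D o3 o2
        + h H [:: i1; i2; i3] - h H [:: i2; i3; i4]) +
   x i3 0 * (- D o2 o3 + D o3 o2 - 2 * D o3 o3
        + h H [:: i1; i2; i3] - h H [:: i2; i3; i4]) +
   x i4 0 * (D o1 o2 - D o1 o3 - D o2 o1 - D o3 o1
        + h H [:: i1; i2; i4] - h H [:: i1; i3; i4])) *
   (t i1 i4 + t i2 i3 =
   x i1 0 * (h H [:: i1; i2; i3] - 2 * D o1 o1)
   - x i2 0 * (h H [:: i1; i2; i4] + (D o1 o2 + D o2 o1))
   - x i3 0 * (h H [:: i1; i3; i4] - (D o3 o1 - D o1 o3))
   + x i4 0 * (h H [:: i2; i3; i4] + (D o2 o3 + D o3 o2))).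
  rewrite /torsion2 !contractE.
  rewrite !(form_repeat3_01, form_repeat3_02).
  rewrite !(form_swap3_01 i1 i2, form_swap3_01 i1 i3, form_swap3_01 i1 i4).
  rewrite !(form_swap3_01 i2 i3, form_swap3_01 i2 i4, form_swap3_01 i3 i4).
  rewrite !(form_swap3_12 _ i2 i3, form_swap3_12 _ i2 i4, form_swap3_12 _ i3 i4).
  rewrite !koszulE /= !eE /=.
  by split; ring.
split=> [t0|[[k1 k2 k3 k4] e1 e2 e3 e4] x].
  have := t0 (evec R i1); have := t0 (evec R i2).
  have := t0 (evec R i3); have := t0 (evec R i4).
  rewrite /= !E !eE /= => -[a1 b1] [a2 b2] [a3 b3] [a4 b4].
  by split; [split|..]; lra.
have [E1 E2] := E x; rewrite /= E1 E2 e1 e2 e3 e4 k1 k2 k3 k4.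
by split; ring.
Qed.

(** The classification in a basis that is already adapted to the spinor.  The ten
    linear equations leave [d11, d12, d21, d22, d32, phi1, phi2] free, with
    [phi_3 = phi_2] and [D_31 = - D_21]; then the first column of [phi o D = 0] is
    [d11 * phi1 = 0], and the other two columns are both the last condition. *)
Lemma null_solutions (gamma : {linear 'rV[R]_4 -> 'M[R]_4}) D (phi : ext_form R 1) H xi :
  clifford_module gamma -> null_spinor gamma xi ->
  [/\ ce_closed D (k := 0) phi,
      ce_closed D (k := 2) H,
      forall x, spin_nabla_torsion gamma D H x xi = 0 &
      form_action gamma phi *m xi = form_action gamma H *m xi] <->
  exists d11 d12 d21 d22 d32 phi1 phi2 : R,
    let D' := mx3 [:: [:: d11;   d12; d12];
                      [:: d21;   d22; - d11 + d22];
                      [:: - d21; d32; d11 + d32]] in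
    [/\ D = D',
        forall X : 'M[R]_(4, 1), phi X =
          phi1 * wedge 1%:M [tuple i1] X
          + phi2 * (wedge 1%:M [tuple i2] X + wedge 1%:M [tuple i3] X)
          + (phi1 + d11 + d22 + d32) * wedge 1%:M [tuple i4] X,
        forall X : 'M[R]_(4, 3), H X =
          2 * d11 * wedge 1%:M [tuple i1; i2; i3] X
          - (d12 + d21) * (wedge 1%:M [tuple i1; i2; i4] X
                           + wedge 1%:M [tuple i1; i3; i4] X)
          + (d11 - d22 - d32) * wedge 1%:M [tuple i2; i3; i4] X &
        [/\ d11 * \tr D' = 0, d11 * phi1 = 0 &
            d12 * phi1 + (d22 + d32) * phi2 = 0]].
Proof.
move=> hg hxi; split.
  case=> /ce_closed1 c1 /ce_closed3 c3 tor.
  have /torsion_system[[h123 h124 h134 h234] e1 e2 e3 e4] :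
      forall x, let t := torsion2 D H x in
       t i1 i2 - t i1 i3 + t i2 i4 - t i3 i4 = 0 /\ t i1 i4 + t i2 i3 = 0.
    by move=> x; apply/(torsion_null hg hxi).
  rewrite (form_action1_null hxi) (form_action3_null hg hxi) => /eqP.
  rewrite -subr_eq0 => /eqP act.
  have [x0 _ _] := hxi.
  have [p1 p2] : phi (basis_mx R 1 [:: i1]) - phi (basis_mx R 1 [:: i4])
        - (h H [:: i2; i3; i4] - h H [:: i1; i2; i3]) = 0
      /\ phi (basis_mx R 1 [:: i2]) - phi (basis_mx R 1 [:: i3])
        - (h H [:: i1; i2; i4] - h H [:: i1; i3; i4]) = 0.
    apply: (indep_e12 hg x0).
    have := congr1 (mulmx (gamma (ecov R i1))) act.
    rewrite mulmx0 mulmxBr !mulmxDr -!scalemxAr !act_sq //= !scale1r => <-.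
    move: (_ *m (_ *m xi)) => u; apply/matrixP=> i j; rewrite !mxE; ring.
  exists (D o1 o1), (D o1 o2), (D o2 o1), (D o2 o2), (D o3 o2).
  exists (phi (basis_mx R 1 [:: i1])), (phi (basis_mx R 1 [:: i2])).
  have DE : D = mx3 [:: [:: D o1 o1; D o1 o2; D o1 o2];
      [:: D o2 o1; D o2 o2; - D o1 o1 + D o2 o2];
      [:: - D o2 o1; D o3 o2; D o1 o1 + D o3 o2]].
    apply/matrixP=> i j; rewrite !mxE.
    by case: (ord3_cases i) => ->; case: (ord3_cases j) => -> /=; lra.
  have p3 : phi (basis_mx R 1 [:: i3]) = phi (basis_mx R 1 [:: i2]) by lra.
  have d31 : D o3 o1 = - D o2 o1 by lra.
  rewrite /= -DE; split=> // [X|X|].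
  - rewrite [LHS]form1_expand p3.
    have -> : phi (basis_mx R 1 [:: i4]) =
      phi (basis_mx R 1 [:: i1]) + D o1 o1 + D o2 o2 + D o3 o2 by lra.
    by ring.
  - rewrite [LHS]form3_expand h123 h124.
    have -> : h H [:: i1; i3; i4] = - (D o1 o2 + D o2 o1) by lra.
    have -> : h H [:: i2; i3; i4] = D o1 o1 - D o2 o2 - D o3 o2 by lra.
    by ring.
  split.
  - by move: c3; rewrite h123; lra.
  - by have := c1 o1; rewrite p3 d31; lra.
  - by have := c1 o2; rewrite p3; lra.
case=> d11 [d12 [d21 [d22 [d32 [f1 [f2]]]]]] /= [DE phiE HE [q1 q2 q3]].
have DE' i j : D i j = nth 0 (nth [::] [:: [:: d11; d12; d12];
    [:: d21; d22; - d11 + d22]; [:: - d21; d32; d11 + d32]] i) j.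
  by rewrite DE mxE.
have W1 a b : wedge 1%:M [tuple a] (basis_mx R 1 [:: b]) = (a == b)%:R.
  by rewrite (@wedge_basis R 1 [tuple a] [tuple b]) // -val_eqE /= eqseq_cons andbT.
have W3 (s t : 3.-tuple 'I_4) : sorted ltn (map val s) -> sorted ltn (map val t) ->
    wedge 1%:M s (basis_mx R 3 t) = (val s == val t)%:R.
  exact: wedge_basis.
have phi_b a : phi (basis_mx R 1 [:: a]) = f1 * (i1 == a)%:R
    + f2 * ((i2 == a)%:R + (i3 == a)%:R) + (f1 + d11 + d22 + d32) * (i4 == a)%:R.
  by rewrite phiE !W1.
have H_b (t : 3.-tuple 'I_4) : sorted ltn (map val t) -> H (basis_mx R 3 t) =
    2 * d11 * ([:: i1; i2; i3] == t)%:R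
    - (d12 + d21) * (([:: i1; i2; i4] == t)%:R + ([:: i1; i3; i4] == t)%:R)
    + (d11 - d22 - d32) * ([:: i2; i3; i4] == t)%:R.
  by move=> ht; rewrite HE !W3.
have h123 := H_b [tuple i1; i2; i3] isT; have h124 := H_b [tuple i1; i2; i4] isT.
have h134 := H_b [tuple i1; i3; i4] isT; have h234 := H_b [tuple i2; i3; i4] isT.
rewrite /= in h123 h124 h134 h234.
split.
- apply/ce_closed1 => j; rewrite !phi_b /= !DE'.
  by case: (ord3_cases j) => -> /=; lra.
- by apply/ce_closed3; rewrite h123 DE; lra.
- move=> x; apply/(torsion_null hg hxi).
  move: x; apply/torsion_system.
  by rewrite h123 h124 h134 h234 !DE' /=; split; [split|..]; lra.
rewrite (form_action1_null hxi) (form_action3_null hg hxi).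
rewrite h123 h124 h134 h234 !phi_b /=.
by congr (_ *: _ + _ *: _); lra.
Qed.

End System.

(** * The classification *)

Lemma pullback_wedge (R : realType) (P : 'M[R]_3) (hP : adapted_basis P) k
    (s : k.-tuple 'I_4) X :
  wedge 1%:M s (invmx (frame P) *m X) = fwedge P s X.
Proof. by rewrite -(wedge_frame hP) mulKVmx // frame_unit. Qed.

Unset Implicit Arguments.
Set Strict Implicit.
Set Printing Implicit Defensive.

Theorem theorem4p17 (R : realType)
    (gamma : {linear 'rV[R]_4 -> 'M[R]_4})
    (hgamma : clifford_module gamma) (hirr : irreducible_module gamma)
    (D : 'M[R]_3) (hD : non_abelian D) (phi : ext_form R 1) (H : ext_form R 3) :
  [/\ ce_closed D (k := 0) phi,
      ce_closed D (k := 2) H &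
      exists xi : 'cV[R]_4,
        [/\ xi != 0,
            chiral gamma 1 xi,
            forall x : 'cV[R]_4, spin_nabla_torsion gamma D H x xi = 0 &
            form_action gamma phi *m xi = form_action gamma H *m xi]]
  <->
  exists P : 'M[R]_3, adapted_basis P /\
    exists d11 d12 d21 d22 d32 phi1 phi2 : R,
      let D' := mx3 [:: [:: d11;   d12; d12];
                        [:: d21;   d22; - d11 + d22];
                        [:: - d21; d32; d11 + d32]] in
      [/\ ad_matrix D P = D',
          forall X : 'M[R]_(4, 1), phi X =
            phi1 * fwedge P [tuple i1] X
            + phi2 * (fwedge P [tuple i2] X + fwedge P [tuple i3] X)
            + (phi1 + d11 + d22 + d32) * fwedge P [tuple i4] X,
          forall X : 'M[R]_(4, 3), H X =
            2 * d11 * fwedge P [tuple i1; i2; i3] X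
            - (d12 + d21) * (fwedge P [tuple i1; i2; i4] X
                             + fwedge P [tuple i1; i3; i4] X)
            + (d11 - d22 - d32) * fwedge P [tuple i2; i3; i4] X &
          [/\ d11 * \tr D' = 0,
              d11 * phi1 = 0 &
              d12 * phi1 + (d22 + d32) * phi2 = 0]].
Proof.
(* By naturality, the equations for [xi] may be read in the basis in which
   [null_solutions] applies to them. *)
have transport (P : 'M[R]_3) (hP : adapted_basis P) xi :
    [/\ ce_closed D (k := 0) phi, ce_closed D (k := 2) H,
        forall x : 'cV[R]_4, spin_nabla_torsion gamma D H x xi = 0 &
        form_action gamma phi *m xi = form_action gamma H *m xi] <->
    [/\ ce_closed (ad_matrix D P) (k := 0) (pullback (frame P) phi),
        ce_closed (ad_matrix D P) (k := 2) (pullback (frame P) H),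
        forall x : 'cV[R]_4, spin_nabla_torsion (frame_gamma P gamma)
          (ad_matrix D P) (pullback (frame P) H) x xi = 0 &
        form_action (frame_gamma P gamma) (pullback (frame P) phi) *m xi =
        form_action (frame_gamma P gamma) (pullback (frame P) H) *m xi].
  rewrite -!(form_action_frame hP hgamma) //.
  split=> -[c1 c3 tor act]; split=> //.
  - exact/(ce_closed_frame hP).
  - exact/(ce_closed_frame hP).
  - by move=> x; rewrite (spin_nabla_torsion_frame hP hgamma).
  - exact/(ce_closed_frame hP)/c1.
  - exact/(ce_closed_frame hP)/c3.
  - move=> x; rewrite -(mulKVmx (frame_unit hP) x).
    by rewrite -(spin_nabla_torsion_frame hP hgamma).
split.
  case=> c1 c3 [xi [x0 hx tor act]].
  have [P [hP hnull]] := chiral_frame hgamma x0 hx.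
  have /(transport P hP) sol : [/\ ce_closed D (k := 0) phi, ce_closed D (k := 2) H,
      forall x : 'cV[R]_4, spin_nabla_torsion gamma D H x xi = 0 &
      form_action gamma phi *m xi = form_action gamma H *m xi] by [].
  exists P; split=> //.
  have [d11 [d12 [d21 [d22 [d32 [f1 [f2 [DE phiE HE eqs]]]]]]]] :=
    (null_solutions _ _ _ (frame_clifford hP hgamma) hnull).1 sol.
  exists d11, d12, d21, d22, d32, f1, f2; split=> // X.
    by have := phiE (invmx (frame P) *m X); rewrite /= mulKVmx ?frame_unit // !pullback_wedge.
  by have := HE (invmx (frame P) *m X); rewrite /= mulKVmx ?frame_unit // !pullback_wedge.
case=> P [hP [d11 [d12 [d21 [d22 [d32 [f1 [f2 [DE phiE HE eqs]]]]]]]]].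
have [xi hnull] := null_exists (frame_clifford hP hgamma).
have hx := null_chiral (frame_clifford hP hgamma) hnull.
have [x0 _ _] := hnull.
have [|c1 c3 tor act] := (transport P hP xi).2; last first.
  split=> //; exists xi; split=> //.
  by move: hx; rewrite /chiral (form_action_vol_frame hP hgamma).
apply/(null_solutions _ _ _ (frame_clifford hP hgamma) hnull).
exists d11, d12, d21, d22, d32, f1, f2; split=> // X.
  by rewrite /= phiE !wedge_frame.
by rewrite /= HE !wedge_frame.
Qed.
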